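(* Let $\alpha\in(0,1)$ and let $\mu$ be a probability measure on $[0,\infty)$ such that $\mu(\{x:x>t\})=t^{-\alpha}L(t)$ for all $t>0$, where $L$ is slowly varying at infinity. Let $V(t)=t^{\alpha}/L(t)$ for $t>0$ and $a_n=1/V^{\leftarrow}(n)$, where $V^{\leftarrow}(t)=\inf\{s>0: V(s)>t\}$. Let $q:[0,\infty)\to[0,\infty)$ be a tempering function, and for $\ell>0$ let $q_\ell(x)=q(x/\ell)$, $c_\ell=\left[\int_{[0,\infty)}q_\ell(x)\,\mu(\mathrm{d}x)\right]^{-1}$ and $\mu_\ell(\mathrm{d}x)=c_\ell q_\ell(x)\,\mu(\mathrm{d}x)$, where $c_\ell\to1$ as $\ell\to\infty$. Let $\{\ell_n\}$ be a sequence of positive numbers with $\ell_n\to\infty$, and for each $n\in\mathbb{N}$ let $X_{n1},X_{n2},\dots,X_{nn}$ be independent and identically distributed with distribution $\mu_{\ell_n}$. Let $D$ be the set of discontinuities of $q$, and assume that the Lebesgue measure of $D$ is $0$. (1) If $a_n\ell_n\to c\in(0,\infty)$, then $a_n\sum_{i=1}^n X_{ni}$ converges in distribution to $PTS_\alpha(q_c,\alpha)$ as $n\to\infty$, where $q_c(x)=q(x/c)$ for $x\ge0$. (2) If $a_n\ell_n\to\infty$, then $a_n\sum_{i=1}^n X_{ni}$ converges in distribution to $PS_\alpha(\alpha)$ as $n\to\infty$. (3) If $a_n\ell_n\to0$ and $\lim_{x\to\infty}q(x)=\zeta<\infty$, then $a_n\sum_{i=1}^n X_{ni}$ converges in distribution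 to $PS_\alpha(\alpha\zeta)$ as $n\to\infty$.
   Context: A function $f$ is regularly varying (at infinity) with index $\beta$ if $\lim_{t\to\infty}f(xt)/f(t)=x^\beta$ for every $x>0$; slowly varying means $\beta=0$. For $b\ge0$ and a Borel measure $M$ on $(0,\infty)$ with $\int_{(0,\infty)}(x\wedge1)M(\mathrm{d}x)<\infty$, $ID_+(M,b)$ denotes the infinitely divisible distribution on $[0,\infty)$ with Laplace transform $z\mapsto\exp\{-bz-\int_{(0,\infty)}(1-e^{-zx})M(\mathrm{d}x)\}$, $z\ge0$. For $\alpha\in(0,1)$ and $\eta\ge0$, $PS_\alpha(\eta)=ID_+(M_\alpha,0)$ with $M_\alpha(\mathrm{d}x)=\eta x^{-1-\alpha}1_{x>0}\,\mathrm{d}x$ (the positive strictly $\alpha$-stable distribution; $PS_\alpha(0)$ is the point mass at $0$). A tempering function (for the given $\alpha\in(0,1)$) is a bounded, non-negative Borel function $q:[0,\infty)\to[0,\infty)$ with $\lim_{x\downarrow0}q(x)=1$ and $\int_0^\infty(1\wedge x)q(x)x^{-1-\alpha}\,\mathrm{d}x<\infty$. For such $q$ and $\eta\ge0$, the positive tempered stable distribution $PTS_\alpha(q,\eta)$ is $ID_+(M,0)$ with $M(\mathrm{d}x)=\eta q(x)x^{-1-\alpha}1_{x>0}\,\mathrm{d}x$. The quantities $a_n$, $c_{\ell_n}$ and $\mu_{\ell_n}$ are only needed for $n$ large enough that they are well defined (i.e. $V^{\leftarrow}(n)>0$ and $\int q_{\ell_n}\,\mathrm{d}\mu>0$). *)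

(* Defs.v *)
From mathcomp Require Export all_boot all_order all_algebra.
From mathcomp Require Export all_classical all_reals all_analysis.

Set Implicit Arguments.
Unset Strict Implicit.
Unset Printing Implicit Defensive.

Import Order.TTheory GRing.Theory Num.Theory.
Import numFieldTopology.Exports numFieldNormedType.Exports.

Local Open Scope classical_set_scope.
Local Open Scope ring_scope.

Definition regularly_varying {R : realType} (f : R -> R) (beta : R) : Prop :=
  forall x : R, 0 < x -> f (x * t) / f t @[t --> +oo] --> x `^ beta.

Definition slowly_varying {R : realType} (f : R -> R) : Prop :=
  regularly_varying f 0.

(* [inf] of a set of reals is 0 when the set is empty; this does not occur for
   the unbounded functions considered here. *)
Definition gen_inverse {R : realType} (V : R -> R) (t : R) : R :=
  inf [set s | 0 < s /\ t < V s].

(* Measures on [0, +oo[ and on ]0, +oo[ are encoded as measures on the whole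
   line, and functions on [0, +oo[ as functions R -> R of which only the
   values on [0, +oo[ are used. *)

Definition has_density {R : realType}
    (M : {measure set (measurableTypeR R) -> \bar R}) (f : R -> R) : Prop :=
  forall A : set R, measurable A ->
    M A = (\int[lebesgue_measure]_(x in A) (f x)%:E)%E.

(* [ID_plus M b nu]: nu is the law ID_+(M, b). A law on [0, +oo[ is determined
   by its Laplace transform, so at most one nu satisfies this. The integral in
   the exponent is real-valued; it is finite by the condition on M. *)
Record ID_plus {R : realType}
    (M : {measure set (measurableTypeR R) -> \bar R}) (b : R)
    (nu : probability (measurableTypeR R) R) : Prop := {
  ID_plus_drift : 0 <= b ;
  ID_plus_levy :
    (\int[M]_(x in `]0%R, +oo[) (Num.min x 1)%:E < +oo)%E ;
  ID_plus_support : nu `[0, +oo[%classic = 1%E ;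
  ID_plus_laplace : forall z : R, 0 <= z ->
    (\int[nu]_(x in `[0%R, +oo[) (expR (- (z * x)))%:E)%E =
    (expR (- (b * z) -
           \int[M]_(x in `]0, +oo[) (1 - expR (- (z * x)))))%:E }.

Definition levy_density {R : realType} (alpha eta : R) (q : R -> R) (x : R) : R :=
  eta * q x * x `^ (- 1 - alpha) * \1_(`]0, +oo[%classic : set R) x.

Definition PS {R : realType} (alpha eta : R)
    (nu : probability (measurableTypeR R) R) : Prop :=
  exists2 M : {measure set (measurableTypeR R) -> \bar R},
    has_density M (levy_density alpha eta (cst 1)) & ID_plus M 0 nu.

Definition PTS {R : realType} (alpha : R) (q : R -> R) (eta : R)
    (nu : probability (measurableTypeR R) R) : Prop :=
  exists2 M : {measure set (measurableTypeR R) -> \bar R},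
    has_density M (levy_density alpha eta q) & ID_plus M 0 nu.

Record tempering {R : realType} (alpha : R) (q : R -> R) : Prop := {
  tempering_measurable : measurable_fun (`[0, +oo[%classic : set R) q ;
  tempering_ge0 : forall x : R, 0 <= x -> 0 <= q x ;
  tempering_bounded : exists K : R, forall x : R, 0 <= x -> q x <= K ;
  tempering_cvg0 : q x @[x --> 0^'+] --> (1 : R) ;
  tempering_integrable :
    (\int[lebesgue_measure]_(x in `]0%R, +oo[)
       (Num.min 1 x * q x * x `^ (- 1 - alpha))%:E < +oo)%E }.

Definition rescale {R : realType} (q : R -> R) (ell : R) (x : R) : R :=
  q (x / ell).

(* Continuity of q is relative to its domain [0, +oo[. *)
Definition discontinuities {R : realType} (q : R -> R) : set R :=
  [set x : R | 0 <= x /\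
           ~ (q y @[y --> within (`[0, +oo[%classic : set R) (nbhs x)] --> q x)].

Definition tempering_mass {R : realType}
    (mu : probability (measurableTypeR R) R) (q : R -> R) (ell : R) : R :=
  \int[mu]_(x in `[0, +oo[) rescale q ell x.

Definition tempering_const {R : realType}
    (mu : probability (measurableTypeR R) R) (q : R -> R) (ell : R) : R :=
  (tempering_mass mu q ell)^-1.

(* Not a probability measure when [tempering_mass mu q ell] is 0. *)
Definition tempered_law {R : realType}
    (mu : probability (measurableTypeR R) R) (q : R -> R) (ell : R)
    (A : set R) : \bar R :=
  (\int[mu]_(x in A `&` `[0%R, +oo[%classic)
     (tempering_const mu q ell * rescale q ell x)%:E)%E.

(* Taking some of the A i to be the whole line gives the product rule for
   every subfamily. *)
Definition mutually_independent {R : realType} d (T : measurableType d)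
    (P : probability T R) n (X : 'I_n -> {RV P >-> R}) : Prop :=
  forall A : 'I_n -> set R, (forall i, measurable (A i)) ->
    P (\bigcap_(i in [set: 'I_n]) (X i @^-1` A i)) =
    (\prod_(i < n) P (X i @^-1` A i))%E.

Definition iid_with_law {R : realType} d (T : measurableType d)
    (P : probability T R) n (X : 'I_n -> {RV P >-> R})
    (law : set R -> \bar R) : Prop :=
  mutually_independent X /\
  forall i (A : set R), measurable A -> distribution P (X i) A = law A.

(* The n-th random variable may live on its own probability space. *)
Definition cvg_in_distribution {R : realType} (d : nat -> measure_display)
    (T : forall n, measurableType (d n)) (P : forall n, probability (T n) R)
    (Y : forall n, T n -> R) (nu : probability (measurableTypeR R) R) : Prop :=
  forall f : R -> R, continuous f -> (exists K : R, forall x, `|f x| <= K) ->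
    ('E_(P n)[f \o Y n])%E @[n --> \oo] --> (\int[nu]_x (f x)%:E)%E.

(* Main.v *)
From HB Require Import structures.
From mathcomp Require Import measurable_realfun.
From mathcomp Require Import ring lra.
Require Import Defs.

(** The Laplace transform of [a n * \sum_(i < n) X n i] is [(1 - y n) ^+ n],
    where [n * y n] is the integral of [1 - expR (- (z * x))] against the image
    of [n c_(ell n) q(x / ell n) mu(dx)] under [x |-> a n * x]. The image of
    [n mu] has tails [n mu(]x / a n, +oo[)], which tend to [x `^ (- alpha)], the
    tails of the stable Levy measure [m]; and the tempering factor, seen at the
    scale of the sums, is [q(x / (a n * ell n))], which tends to [q(x / c)], to
    [1] or to [zeta] in the three cases. Hence [n * y n] should converge to the
    integral of [1 - expR (- (z * x))] against the limiting Levy measure, the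
    Laplace transforms to the one of the announced law, and the laws with them.

    Two passages to the limit have to be justified: the one under the integral
    against measures that vary with [n], of functions that may be
    discontinuous, and the one from Laplace transforms to laws. Both are turned
    into dominated convergence by one device, the coupling by quantiles. The
    function [quantile T] is the inverse of the tail function [T] of a measure,
    and sends Lebesgue measure to that measure on ]0, +oo[ ([quantile_coupling],
    [integral_quantile]). When tails converge, their quantiles converge at every
    point of continuity of the limit ([quantile_cvg]), that is, off a countable
    set ([quantile_continuity_ae]).

    For the exponents ([levy_exponent_cvg]) the domination near [x = 0] is a
    Potter bound. With [F t] for [mu(]t, +oo[)], regular variation gives
    [n F(x / a n) <= C x `^ (- a')] for [x] in ]0, 1] and some [a'] in
    ]alpha, 1[ ([potter_bound]), so that the quantiles are dominated by an
    integrable power ([min1_quantile_le]). The convergence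
    [n F(x / a n) --> x `^ (- alpha)] is [gen_inverse_norming].

    For the laws ([laplace_continuity_theorem]), a polynomial in
    [expR (- (m * y))] approximates the indicator of [y > t]
    ([double_exponential_step]), so convergence of the Laplace transforms
    squeezes the tails, hence makes the quantiles converge. The limit law is by
    definition the law of the limiting quantile of a uniform variable. This also
    provides the existence of the infinitely divisible laws: they are obtained
    as limits of the sums themselves. *)

Set Implicit Arguments.
Unset Strict Implicit.
Unset Printing Implicit Defensive.

Import Order.TTheory GRing.Theory Num.Theory.
Import numFieldTopology.Exports numFieldNormedType.Exports.

Local Open Scope classical_set_scope.
Local Open Scope ring_scope.

(** * Measures with a density *)

Lemma density_measure {d} {T : measurableType d} {R : realType}
    (m : {measure set T -> \bar R}) (g : T -> R) :
  measurable_fun [set: T] g -> (forall x, 0 <= g x) ->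
  exists M : {measure set T -> \bar R},
    forall A, M A = (\int[m]_(x in A) (g x)%:E)%E.
Proof.
move=> mg g0.
pose M A := (\int[m]_(x in A) (g x)%:E)%E.
have M0 : M set0 = 0%E by rewrite /M integral_set0.
have M_ge0 A : (0 <= M A)%E.
  by apply: integral_ge0 => x _; rewrite lee_fin.
have M_sigma_additive : semi_sigma_additive M.
  move=> /= F mF tF mUF; rewrite /M; apply: cvg_toP.
    apply: ereal_nondecreasing_is_cvgn => i n le_in.
    apply: lee_sum_nneg_natr => // k _ _.
    by apply: integral_ge0 => x _; rewrite lee_fin.
  rewrite ge0_integral_bigcup//=.
    by apply/measurable_EFinP; exact: measurable_funTS.
  by move=> x _; rewrite lee_fin.
pose ism := isMeasure.Build _ _ _ M M0 M_ge0 M_sigma_additive.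
pose M_measure : {measure set T -> \bar R} := HB.pack M ism.
by exists M_measure.
Qed.

Import HBNNSimple.

(** Simple functions approximate [h] from below; for them, the identity is the
    definition of [M] on the level sets. *)
Lemma ge0_integral_density {d} {T : measurableType d} {R : realType}
    (m M : {measure set T -> \bar R}) (g : T -> R) :
  measurable_fun [set: T] g -> (forall x, 0 <= g x) ->
  (forall A, measurable A -> M A = (\int[m]_(x in A) (g x)%:E)%E) ->
  forall h : T -> \bar R, measurable_fun [set: T] h -> (forall x, 0 <= h x)%E ->
    (\int[M]_x h x = \int[m]_x (h x * (g x)%:E))%E.
Proof.
move=> mg g0 ME h mh h0.
have mTg : measurable_fun [set: T] (EFin \o g) by exact/measurable_EFinP.
pose s := nnsfun_approx measurableT mh.
have s_cvg x : EFin (s n x) @[n --> \oo] --> h x.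
  by apply: (cvg_nnsfun_approx measurableT mh) => // y _.
have s_nd x : {homo (fun n => s n x) : p q / (p <= q)%N >-> p <= q}.
  by move=> p q pq; exact/lefP/nd_nnsfun_approx.
have -> : (\int[M]_x h x = limn (fun n => \int[M]_x (s n x)%:E))%E.
  rewrite -monotone_convergence//.
  - by apply: eq_integral => x _; apply/esym/cvg_lim => //; exact: s_cvg.
  - by move=> n; exact/measurable_EFinP/measurable_funP.
  - by move=> n x _; rewrite lee_fin.
  - by move=> x _ p q pq; rewrite lee_fin s_nd.
have -> : (\int[m]_x (h x * (g x)%:E) =
           limn (fun n => \int[m]_x ((s n x)%:E * (g x)%:E)))%E.
  rewrite -monotone_convergence//.
  - apply: eq_integral => x _; apply/esym/cvg_lim => //.
    by apply: cvgeZr => //; exact: s_cvg.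
  - move=> n; apply: emeasurable_funM => //.
    exact/measurable_EFinP/measurable_funP.
  - by move=> n x _; rewrite mule_ge0// lee_fin.
  - move=> x _ p q pq; rewrite lee_wpmul2r ?lee_fin//; exact: s_nd.
congr (limn _); apply/funext => n.
have ms y : measurable (s n @^-1` [set y]) by [].
transitivity (\int[M]_x
    (\sum_(y \in range (s n)) (y * \1_(s n @^-1` [set y]) x)%:E))%E.
  by apply: eq_integral => x _; rewrite fimfunE -fsumEFin.
rewrite ge0_integral_fsum//; last 2 first.
- by move=> y; exact/measurable_EFinP/measurable_funM.
- by move=> y x _; exact: nnfun_muleindic_ge0.
transitivity (\int[m]_x (\sum_(y \in range (s n))
    ((y * \1_(s n @^-1` [set y]) x)%:E * (g x)%:E)))%E; last first.
  apply: eq_integral => x _; rewrite -ge0_mule_fsuml; last first.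
    by move=> y; exact: nnfun_muleindic_ge0.
  by rewrite fsumEFin// -fimfunE.
rewrite ge0_integral_fsum//; last 2 first.
- move=> y; apply: emeasurable_funM => //.
  exact/measurable_EFinP/measurable_funM.
- move=> y x _; apply: mule_ge0; last by rewrite lee_fin.
  exact: nnfun_muleindic_ge0.
apply: eq_fsbigr => y /[!inE] -[t _ <-{y}].
under eq_integral do rewrite EFinM.
rewrite integralZl_indic_nnsfun//.
under [RHS]eq_integral do rewrite EFinM -muleA.
rewrite ge0_integralZl//; last 3 first.
- apply: emeasurable_funM => //.
  by apply/measurable_EFinP; exact: measurable_indic.
- by move=> x _; rewrite mule_ge0// lee_fin.
- by rewrite lee_fin.
congr (_ * _)%E; rewrite integral_indic// setIT ME//.
rewrite integral_mkcond; apply: eq_integral => x _.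
by rewrite epatch_indic muleC.
Qed.

(** * Independence and products *)

(** Indicators are replaced by the functions [h i] one coordinate at a time.
    To replace the one of coordinate [k], the other factors are put into a
    density [g]: under [g P], the law of [X k] is a constant multiple of its
    law under [P], since on a set [B] this is the induction hypothesis with
    the indicator of [B] at coordinate [k]. *)
Lemma integral_prod_indep {R : realType} {d} {T : measurableType d}
    (P : probability T R) n (X : 'I_n -> {RV P >-> R}) (h : 'I_n -> R -> R) :
  mutually_independent X ->
  (forall i, measurable_fun [set: R] (h i)) ->
  (forall i x, 0 <= h i x <= 1) ->
  (\int[P]_w (\prod_(i < n) h i (X i w))%:E =
   \prod_(i < n) \int[P]_w (h i (X i w))%:E)%E.
Proof.
move=> indepX mh h01.
pose f (A : 'I_n -> set R) j (i : 'I_n) x : R :=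
  if (i < j)%N then h i x else \1_(A i) x.
have mf A j : (forall i, measurable (A i)) ->
    forall i, measurable_fun [set: R] (f A j i).
  move=> mA i; rewrite /f; case: (i < j)%N; first exact: mh.
  exact: measurable_indic.
have f01 A j i x : 0 <= f A j i x <= 1.
  rewrite /f; case: ifP => // _; rewrite indicE.
  by case: (_ \in _); rewrite ?lexx ler01.
have mfX A j i : (forall i, measurable (A i)) ->
    measurable_fun [set: T] (fun w => f A j i (X i w)).
  by move=> mA; apply: measurableT_comp => //; exact: mf.
suff key j : (j <= n)%N -> forall A, (forall i, measurable (A i)) ->
    (\int[P]_w (\prod_(i < n) f A j i (X i w))%:E =
     \prod_(i < n) \int[P]_w (f A j i (X i w))%:E)%E.
  have fE i x : f (fun=> setT) n i x = h i x by rewrite /f ltn_ord.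
  have := key n (leqnn n) (fun=> setT) (fun=> measurableT).
  under eq_integral do under eq_bigr do rewrite fE.
  move=> ->; apply: eq_bigr => i _.
  by apply: eq_integral => w _; rewrite fE.
elim: j => [_ A mA|j ih jn A mA].
  have f0 i x : f A 0 i x = \1_(A i) x by [].
  transitivity (\int[P]_w
      (\1_(\bigcap_(i in [set: 'I_n]) (X i @^-1` A i)) w)%:E)%E.
    apply: eq_integral => w _; congr EFin.
    under eq_bigr do rewrite f0.
    rewrite [RHS]indicE; case: (boolP (w \in _)) => [/set_mem Aw|Aw].
      by rewrite big1// => i _; rewrite indicE mem_set//; exact: Aw.
    have [i Ai] : exists i, ~ A i (X i w).
      apply/existsNP; apply: contraNnot Aw => Aw.
      by apply/mem_set => i _; exact: Aw.
    by rewrite (bigD1 i)//= indicE memNset ?mul0r.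
  rewrite integral_indic//; last first.
    by apply: fin_bigcap_measurable => // i _; exact: measurable_funPTI.
  rewrite setIT; transitivity (\prod_(i < n) P (X i @^-1` A i))%E.
    exact: (indepX A mA).
  apply: eq_bigr => i _.
  have -> : P (X i @^-1` A i) = (\int[P]_w (\1_(X i @^-1` A i) w)%:E)%E.
    by rewrite integral_indic// ?setIT//; exact: measurable_funPTI.

  by apply: eq_integral => w _; rewrite f0.
pose k := Ordinal jn.
have fS i x : i != k -> f A j.+1 i x = f A j i x.
  move=> ik; rewrite /f ltnS leq_eqVlt; case: eqP => // ij.
  by move: ik; rewrite -val_eqE/= ij eqxx.
have fk x : f A j.+1 k x = h k x by rewrite /f ltnSn.
pose g w := \prod_(i < n | i != k) f A j i (X i w).
pose c := \prod_(i < n | i != k) fine (\int[P]_w (f A j i (X i w))%:E)%E.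
have g0 w : 0 <= g w by apply: prodr_ge0 => i _; case/andP: (f01 A j i (X i w)).
have mg : measurable_fun [set: T] g.
  rewrite (_ : g = fun w => \prod_(i < n) if i != k then f A j i (X i w) else 1).
    apply: measurable_prod => i _; case: (i != k); first exact: mfX.
    exact: measurable_cst.
  by apply/funext => w; rewrite /g big_mkcond.
have intf i : (\int[P]_w (f A j i (X i w))%:E)%E \is a fin_num.
  rewrite ge0_fin_numE; last first.
    by apply: integral_ge0 => w _; rewrite lee_fin; case/andP: (f01 A j i (X i w)).
  apply: (@le_lt_trans _ _ (\int[P]_w (cst 1%E) w)%E); last first.
    by rewrite integral_cst// mul1e -ge0_fin_numE// fin_num_measure.
  apply: ge0_le_integral => //.
  - by move=> w _; rewrite lee_fin; case/andP: (f01 A j i (X i w)).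
  - by apply/measurable_EFinP; exact: mfX.
  - by move=> w _; rewrite lee_fin; case/andP: (f01 A j i (X i w)).
have cE : (\prod_(i < n | i != k) \int[P]_w (f A j i (X i w))%:E = c%:E)%E.
  by rewrite -prodEFin; apply: eq_bigr => i _; rewrite fineK.
have c0 : 0 <= c.
  apply: prodr_ge0 => i _; apply/fine_ge0/integral_ge0 => w _.
  by rewrite lee_fin; case/andP: (f01 A j i (X i w)).
have [D DE] := density_measure P mg g0.
pose law := distribution P (X k).
pose m1 := pushforward D (X k).
have m1E B : measurable B -> m1 B = (\int[law]_(x in B) c%:E)%E.
  move=> mB; rewrite [RHS](integral_cst _ mB) /m1 /pushforward DE.
  pose A' i := if i == k then B else A i.
  have mA' i : measurable (A' i) by rewrite /A'; case: ifP.
  have fA' i x : i != k -> f A' j i x = f A j i x.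
    by move=> /negbTE ik; rewrite /f /A' ik.
  have fA'k x : f A' j k x = \1_B x by rewrite /f /A' ltnn eqxx.
  transitivity (\int[P]_w (\prod_(i < n) f A' j i (X i w))%:E)%E.
    rewrite integral_mkcond; apply: eq_integral => w _.
    rewrite epatch_indic (bigD1 k)//= fA'k -EFinM mulrC; congr (_ * _)%:E.
    by apply: eq_bigr => i ik; rewrite fA'.
  rewrite ih//; last exact: ltnW.
  rewrite (bigD1 k)//= muleC; congr (_ * _)%E; last first.
    under eq_integral do rewrite fA'k.
    by rewrite integral_indic// ?setIT//; exact: measurable_funPTI.
  rewrite -cE; apply: eq_bigr => i ik.
  by apply: eq_integral => w _; rewrite fA'.
have mh' : measurable_fun [set: R] (EFin \o h k).
  by apply/measurable_EFinP; exact: mh.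
have h0 x : (0 <= (EFin \o h k) x)%E by rewrite lee_fin; case/andP: (h01 k x).
transitivity (\int[P]_w ((h k (X k w))%:E * (g w)%:E))%E.
  apply: eq_integral => w _; rewrite (bigD1 k)//= fk; congr (_ * _)%:E.
  by apply: eq_bigr => i ik; rewrite fS.
rewrite -(@ge0_integral_density _ _ _ P D g mg g0 (fun A _ => DE A)
  (fun w => (h k (X k w))%:E)); last 2 first.
- by apply/measurable_EFinP; apply: measurableT_comp => //; exact: mh.
- by move=> w; exact: h0.
transitivity (\int[m1]_x (EFin \o h k) x)%E.
  by rewrite /m1 ge0_integral_pushforward.
rewrite (@ge0_integral_density _ _ _ law m1 (cst c))//.
transitivity (\int[distribution P (X k)]_x ((EFin \o h k) x * c%:E))%E => //.
rewrite ge0_integralZr//.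
rewrite ge0_integral_distribution// (bigD1 k)//= -cE; congr (_ * _)%E.
  by apply: eq_integral => w _; rewrite /= fk.
by apply: eq_bigr => i ik; apply: eq_integral => w _; rewrite fS.
Qed.

(** * Quantile functions and the coupling with Lebesgue measure *)

(** Inverting tails rather than distribution functions keeps the definition
    meaningful for measures that are infinite near 0. The value 0 for [u <= 0]
    lets the whole line carry the coupling: only values in ]0, +oo[ count. *)
Definition quantile {R : realType} (T : R -> R) (u : R) : R :=
  if 0 < u then inf [set x | 0 < x /\ T x <= u] else 0.

Record tail_function {R : realType} (T : R -> R) : Prop := {
  tail_ge0 : forall x, 0 < x -> 0 <= T x ;
  tail_le : forall x y, 0 < x -> x <= y -> T y <= T x ;
  tail_small : forall u, 0 < u -> exists2 x, 0 < x & T x <= u }.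

Lemma quantile_le0 {R : realType} (T : R -> R) u : u <= 0 -> quantile T u = 0.
Proof. by move=> u0; rewrite /quantile ltNge u0. Qed.

Lemma quantile_ge0 {R : realType} (T : R -> R) u : 0 <= quantile T u.
Proof.
rewrite /quantile; case: ifP => // _.
have [S0|/set0P S0] := eqVneq [set x | 0 < x /\ T x <= u] set0.
  by rewrite S0 inf0.
by apply: lb_le_inf => // x [/ltW].
Qed.

Lemma quantile_le {R : realType} (T : R -> R) u x :
  0 < u -> 0 < x -> T x <= u -> quantile T u <= x.
Proof.
move=> u0 x0 Tx; rewrite /quantile u0; apply: ge_inf => //=.
by exists 0 => y [/ltW].
Qed.

Lemma quantile_ge {R : realType} (T : R -> R) u x : tail_function T ->
  0 < u -> 0 < x -> u < T x -> x <= quantile T u.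
Proof.
move=> tT u0 x0 uTx; rewrite /quantile u0; apply: lb_le_inf.
  by have [y y0 Ty] := tail_small tT u0; exists y.
move=> y [y0 Ty]; rewrite leNgt; apply/negP => yx.
by have := tail_le tT y0 (ltW yx); rewrite leNgt (le_lt_trans Ty uTx).
Qed.

Lemma quantile_nonincreasing {R : realType} (T : R -> R) u v :
  tail_function T -> 0 < u -> u <= v -> quantile T v <= quantile T u.
Proof.
move=> tT u0 uv; rewrite /quantile u0 (lt_le_trans u0 uv).
apply: lb_le_inf.
  by have [y y0 Ty] := tail_small tT u0; exists y.
move=> y [y0 Ty]; apply: ge_inf => /=; first by exists 0 => z [/ltW].
by split => //; exact: le_trans Ty uv.
Qed.

Lemma measurable_quantile {R : realType} (T : R -> R) :
  tail_function T -> measurable_fun [set: R] (quantile T).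
Proof.
move=> tT.
have -> : quantile T = quantile T \_ `]0, +oo[.
  apply/funext => u; rewrite patchE mem_setE in_itv/= andbT.
  by case: ifP => // u0; rewrite /quantile u0.
apply: (iffLR (measurable_restrictT _ (measurable_itv _))).
apply: (measurability (@RGenCInfty.G R)) => [|/= _ [_] [r] -> <-].
  exact: RGenCInfty.measurableE.
apply: is_interval_measurable => s t /= [].
rewrite !in_itv/= !andbT => s0 rs [t0 rt] u /andP[su ut].
rewrite !in_itv/= !andbT (lt_le_trans s0 su); split => //.
by apply: (le_trans rt); apply: quantile_nonincreasing => //; exact: lt_le_trans su.
Qed.

(** Rays form a generating pi-system, but the measures may be infinite near 0:
    uniqueness is applied to the restrictions to ]1/(k+1), +oo[, which exhaust
    ]0, +oo[. *)
Lemma measure_eq_rays {R : realType}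
    (m1 m2 : {measure set (measurableTypeR R) -> \bar R}) :
  (forall x : R, 0 < x -> m1 `]x, +oo[%classic = m2 `]x, +oo[%classic) ->
  (forall x : R, 0 < x -> (m1 `]x, +oo[%classic < +oo)%E) ->
  forall A : set R, measurable A -> A `<=` `]0, +oo[ -> m1 A = m2 A.
Proof.
move=> m12 m1fin A mA A0.
pose D k : set R := `]k.+1%:R^-1, +oo[%classic.
have mD k : measurable (D k : set (measurableTypeR R)) by exact: measurable_itv.
have D0 k : 0 < k.+1%:R^-1 :> R by rewrite invr_gt0.
have rayI (x y : R) : `]x, +oo[%classic `&` `]y, +oo[%classic =
    `](Num.max x y), +oo[%classic :> set R.
  by apply/seteqP; split => z /=; rewrite !in_itv/= !andbT gt_max => /andP.
have restr k : m1 (A `&` D k) = m2 (A `&` D k).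
  apply: (@measure_unique _ R (measurableTypeR R) (RGenOInfty.G (R:=R))
    (fun n => `](- n%:R), +oo[%classic) _ _ _ _
    (mrestr m1 (mD k)) (mrestr m2 (mD k))) => //.
  - exact: RGenOInfty.measurableE.
  - by move=> _ _ [x ->] [y ->]; exists (Num.max x y); rewrite rayI.
  - by move=> n; exists (- n%:R).
  - apply/seteqP; split => // x _; exists (Num.truncn `|x|).+1 => //=.
    by rewrite in_itv/= andbT ltrNl (le_lt_trans (ler_norm _))// normrN truncnS_gt.
  - move=> _ [x ->]; rewrite /= /mrestr rayI m12//.
    by rewrite lt_max D0 orbT.
  - by move=> n; rewrite /= /mrestr rayI m1fin// lt_max D0 orbT.
have AE : A = \bigcup_k (A `&` D k).
  apply/seteqP; split => [x Ax|x [k _ []]//].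
  have := A0 _ Ax; rewrite /= in_itv/= andbT => x0.
  exists (Num.truncn x^-1) => //; split => //; rewrite /D /= in_itv/= andbT.
  by rewrite invf_plt ?posrE// truncnS_gt.
have mAD k : measurable (A `&` D k : set (measurableTypeR R)).
  exact: measurableI.
have ndAD : {homo (fun k => A `&` D k) : n m / (n <= m)%N >-> (n <= m)%O}.
  move=> p q pq; apply/subsetPset => x [Ax]; rewrite /D /= !in_itv/= !andbT.
  move=> px; split => //; apply: le_lt_trans px.
  by rewrite lef_pV2 ?posrE ?ltr0n// ler_nat ltnS.
have mU : measurable (\bigcup_k (A `&` D k) : set (measurableTypeR R)).
  exact: bigcup_measurable.
have c1 := nondecreasing_cvg_mu (mu := m1) mAD mU ndAD.
have c2 := nondecreasing_cvg_mu (mu := m2) mAD mU ndAD.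
rewrite AE -(cvg_lim _ c1)// -(cvg_lim _ c2)//.
by congr (limn _); apply/funext => k /=; exact: restr.
Qed.

(** The rays [`]x + 1/(k+1), +oo[] increase to [`]x, +oo[]. *)
Lemma tail_right_continuous {R : realType}
    (m : {measure set (measurableTypeR R) -> \bar R}) (T : R -> R) (x u : R) :
  (forall y, x <= y -> m `]y, +oo[%classic = (T y)%:E) -> u < T x ->
  exists2 y, x < y & u < T y.
Proof.
move=> mT uTx.
pose D k : set R := `](x + k.+1%:R^-1), +oo[%classic.
have D0 k : 0 < k.+1%:R^-1 :> R by rewrite invr_gt0.
have DE : `]x, +oo[%classic = \bigcup_k D k.
  apply/seteqP; split => [y|y [k _]].
    rewrite /= in_itv/= andbT => xy.
    exists (Num.truncn (y - x)^-1) => //=; rewrite /D /= in_itv/= andbT -ltrBrDl.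
    by rewrite invf_plt ?posrE ?subr_gt0// truncnS_gt.
  by rewrite /D /= !in_itv/= !andbT; apply: lt_trans; rewrite ltrDl.
have ndD : {homo D : n m / (n <= m)%N >-> (n <= m)%O}.
  move=> p q pq; apply/subsetPset => y; rewrite /D /= !in_itv/= !andbT.
  apply: le_lt_trans.
  by rewrite lerD2l lef_pV2 ?posrE ?ltr0n// ler_nat ltnS.
have mD k : measurable (D k : set (measurableTypeR R)) by exact: measurable_itv.
have := nondecreasing_cvg_mu (mu := m) mD _ ndD.
rewrite -DE => /(_ (measurable_itv _)); rewrite mT// => c.
apply: contrapT => noy.
have DTu k : (m (D k) <= u%:E)%E.
  have -> : m (D k) = (T (x + k.+1%:R^-1))%:E by apply: mT; rewrite lerDl ltW.
  rewrite lee_fin leNgt; apply/negP => uT.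
  by apply: noy; exists (x + k.+1%:R^-1); rewrite ?ltrDl.
have : ((T x)%:E <= u%:E)%E by apply: (cvge_to_le c); exact: nearW.
by rewrite lee_fin leNgt uTx.
Qed.

(** [quantile T u] exceeds [x] exactly when [0 < u < T x]; that [u < T x]
    suffices is right continuity of [T]. *)
Lemma lebesgue_quantile_ray {R : realType}
    (m : {measure set (measurableTypeR R) -> \bar R}) (T : R -> R) :
  tail_function T -> (forall x, 0 < x -> m `]x, +oo[%classic = (T x)%:E) ->
  forall x, 0 < x ->
    lebesgue_measure (quantile T @^-1` `]x, +oo[%classic) = (T x)%:E.
Proof.
move=> tT mT x x0.
have -> : quantile T @^-1` `]x, +oo[%classic = `]0, (T x)[%classic.
  apply/seteqP; split => u /=; rewrite !in_itv/= andbT.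
    move=> xQ; case: (ltP 0 u) => [u0|u0]/=; last first.
      by move: xQ; rewrite quantile_le0// ltNge (ltW x0).
    by rewrite ltNge; apply: contraTN xQ => Tu; rewrite -leNgt quantile_le.
  move=> /andP[u0 uT].
  have [y xy uTy] := @tail_right_continuous _ m T x u
    (fun y xy => mT y (lt_le_trans x0 xy)) uT.
  by apply: (lt_le_trans xy); apply: quantile_ge => //; exact: lt_trans xy.
rewrite lebesgue_measure_itv/= lte_fin oppr0 adde0.
case: ifPn => //; rewrite -leNgt => Tx; congr EFin; apply/esym.
by apply/eqP; rewrite eq_le Tx tail_ge0.
Qed.

(** Inverse transform sampling for a measure of possibly infinite mass near 0:
    both sides give the same mass to each ray. *)
Lemma quantile_coupling {R : realType}
    (m : {measure set (measurableTypeR R) -> \bar R}) (T : R -> R) :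
  tail_function T -> (forall x, 0 < x -> m `]x, +oo[%classic = (T x)%:E) ->
  forall A : set R, measurable A -> A `<=` `]0, +oo[ ->
    m A = lebesgue_measure (quantile T @^-1` A).
Proof.
move=> tT mT A mA A0.
have mQ : measurable_fun (T := measurableTypeR R) (U := measurableTypeR R)
    [set: R] (quantile T) by exact: measurable_quantile.
pose mphi := isMeasurableFun.Build _ _ _ _ _ mQ.
pose Q : {mfun (measurableTypeR R) >-> (measurableTypeR R)} :=
  HB.pack (quantile T) mphi.
apply: (@measure_eq_rays R m (pushforward lebesgue_measure Q)) => // x x0.
  by rewrite mT// -(lebesgue_quantile_ray tT mT).
by rewrite mT// ltry.
Qed.

Lemma integral_quantile {R : realType}
    (m : {measure set (measurableTypeR R) -> \bar R}) (T : R -> R) :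
  tail_function T -> (forall x, 0 < x -> m `]x, +oo[%classic = (T x)%:E) ->
  forall f : R -> \bar R, measurable_fun [set: R] f ->
    (forall x, 0 <= f x)%E -> (forall x, x <= 0 -> f x = 0%E) ->
    (\int[m]_x f x = \int[lebesgue_measure]_u f (quantile T u))%E.
Proof.
move=> tT mT f mf f0 fN.
have mQ : measurable_fun (T := measurableTypeR R) (U := measurableTypeR R)
    [set: R] (quantile T) by exact: measurable_quantile.
pose mphi := isMeasurableFun.Build _ _ _ _ _ mQ.
pose Q : {mfun (measurableTypeR R) >-> (measurableTypeR R)} :=
  HB.pack (quantile T) mphi.
have fE : f = f \_ `]0, +oo[.
  apply/funext => x; rewrite patchE mem_setE in_itv/= andbT.
  by case: ltP => // x0; rewrite fN.
transitivity (\int[m]_(x in `]0%R, +oo[) f x)%E.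
  by rewrite [RHS]integral_mkcond -fE.
transitivity (\int[pushforward lebesgue_measure Q]_(x in `]0%R, +oo[) f x)%E.
  by apply: eq_measure_integral => A mA A0; exact: quantile_coupling.
rewrite ge0_integral_pushforward//; last exact: measurable_funTS.
rewrite integral_mkcond; apply: eq_integral => u _; rewrite patchE/=.
case: ifPn => // /negP; rewrite inE/= in_itv/= andbT => /negP.
by rewrite -leNgt => /fN ->.
Qed.

(** * Convergence of quantiles *)

(** Continuity of a nonincreasing function is one inequality on each side of
    [u]; a failure of either is a jump. *)
Definition quantile_continuity_point {R : realType} (H : R -> R) (u : R) :=
  [/\ 0 < u,
    forall e, 0 < e -> exists2 v, 0 < v < u & quantile H v < quantile H u + e &
    forall e, 0 < e -> exists2 v, u < v & quantile H u - e < quantile H v].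

(** Tails are compared at two distinct points [s < t], which is all that weak
    convergence provides at a jump of [H]. A level slightly below [u] bounds
    [T n] at [quantile H u + e] by [u], and one slightly above bounds it from
    below at [quantile H u - e]. *)
Lemma quantile_cvg {R : realType} (T : nat -> R -> R) (H : R -> R) (u : R) :
  (forall n, tail_function (T n)) -> tail_function H ->
  (forall s t e, 0 < s -> s < t -> 0 < e ->
    \forall n \near \oo, T n t <= H s + e) ->
  (forall s t e, 0 < s -> s < t -> 0 < e ->
    \forall n \near \oo, H t <= T n s + e) ->
  quantile_continuity_point H u ->
  quantile (T n) u @[n --> \oo] --> quantile H u.
Proof.
move=> tT tH up lo [u0 Cl Cr]; set q := quantile H u.
have q0 : 0 <= q := quantile_ge0 H u.
apply/cvgrPdist_le => e e0.
have e20 : 0 < e / 2 by rewrite divr_gt0.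
have upper : \forall n \near \oo, quantile (T n) u <= q + e.
  have [v /andP[v0 vu] Qv] := Cl _ e20.
  have s0 : 0 < q + e / 2 by rewrite ltr_wpDl.
  have st : q + e / 2 < q + e by rewrite ltrD2l gtr_pMr// invf_lt1// ltr1n.
  have Hs : H (q + e / 2) <= v.
    rewrite leNgt; apply/negP => /(quantile_ge tH v0 s0).
    by rewrite leNgt Qv.
  have uv0 : 0 < u - v by rewrite subr_gt0.
  apply: filterS (up _ _ _ s0 st uv0) => n Tn; apply: quantile_le => //.
    exact: lt_trans st.
  by move: Tn Hs; lra.
have lower : \forall n \near \oo, q - e <= quantile (T n) u.
  have [qe|qe] := leP (q - e) 0.
    by apply: nearW => n; apply: (le_trans qe); exact: quantile_ge0.
  have [v uv Qv] := Cr _ e20.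
  have st : q - e < q - e / 2.
    by rewrite ltrD2l ltrN2 gtr_pMr// invf_lt1// ltr1n.
  have Ht : v < H (q - e / 2).
    rewrite ltNge; apply/negP => Ht.
    have := quantile_le (lt_trans u0 uv) (lt_trans qe st) Ht.
    by rewrite leNgt Qv.
  have uv0 : 0 < v - u by rewrite subr_gt0.
  apply: filterS (lo _ _ _ qe st uv0) => n Tn; apply: quantile_ge => //.
  by move: Ht Tn; lra.
near=> n; rewrite ler_distlC; apply/andP; split; near: n => //.
Unshelve. all: by end_near. Qed.

(** Each interval contains a rational number, and these are distinct. *)
Lemma countable_disjoint_itv {R : realType} (D : set R) (lo hi : R -> R) :
  (forall u, D u -> lo u < hi u) ->
  (forall u v, D u -> D v -> u < v -> hi v <= lo u) -> countable D.
Proof.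
move=> lohi hilo.
have /choice[r rP] u : exists r : rat, D u -> lo u < ratr r < hi u.
  have [Du|nDu] := pselect (D u); last by exists 0.
  by have [r] := rat_in_itvoo (lohi _ Du); rewrite in_itv/= => ?; exists r.
apply/countable_injP; exists (fun u => choice.pickle (r u)).
move=> u v /set_mem Du /set_mem Dv /(pcan_inj choice.pickleK) ruv.
have main x y : D x -> D y -> x < y -> r x = r y -> False.
  move=> Dx Dy xy rxy; have /andP[rx _] := rP x Dx; have /andP[_ ry] := rP y Dy.
  have := lt_le_trans ry (hilo _ _ Dx Dy xy).
  by rewrite -rxy ltNge (ltW rx).
by case: (ltgtP u v) => // [uv|vu]; [case: (main u v)|case: (main v u)].
Qed.

(** The jumps of a nonincreasing function span disjoint intervals. Left and
    right jumps at [u] lie on opposite sides of the value at [u], hence two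
    families. *)
Lemma quantile_discontinuity_countable {R : realType} (H : R -> R) :
  tail_function H ->
  countable [set u | 0 < u /\ ~ quantile_continuity_point H u].
Proof.
move=> tH; set Q := quantile H.
pose jumpl u e := 0 < e /\ forall v, 0 < v < u -> Q u + e <= Q v.
pose jumpr u e := 0 < e /\ forall v, u < v -> Q v <= Q u - e.
have cl : countable [set u | 0 < u /\ exists e, jumpl u e].
  have /choice[e eP] u : exists e, (exists e', jumpl u e') -> jumpl u e.
    by have [[e ?]|n] := pselect (exists e, jumpl u e); [exists e|exists 0].
  apply: (@countable_disjoint_itv _ _ Q (fun u => Q u + e u)).
    by move=> u [u0 /eP[e0 _]]; rewrite ltrDl.
  by move=> u v [u0 _] [v0 /eP[_]] + uv; apply; rewrite u0.
have cr : countable [set u | 0 < u /\ exists e, jumpr u e].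
  have /choice[e eP] u : exists e, (exists e', jumpr u e') -> jumpr u e.
    by have [[e ?]|n] := pselect (exists e, jumpr u e); [exists e|exists 0].
  apply: (@countable_disjoint_itv _ _ (fun u => Q u - e u) Q).
    by move=> u [u0 /eP[e0 _]]; rewrite ltrBlDr ltrDl.
  by move=> u v [u0 /eP[_]] + [v0 _] uv; apply.
pose F (b : bool) := [set u | 0 < u /\ exists e, (if b then jumpl else jumpr) u e].
have cF : countable (\bigcup_b F b) by apply: bigcup_countable => // -[].
apply: sub_countable cF; apply: subset_card_le => u [u0 nC].
apply: contrapT => nF; apply: nC; split => //.
- move=> e e0; apply: contrapT => nv; apply: nF; exists true => //.
  split => //; exists e; split => // v vu; rewrite leNgt; apply/negP => Qv.
  by apply: nv; exists v.
- move=> e e0; apply: contrapT => nv; apply: nF; exists false => //.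
  split => //; exists e; split => // v vu; rewrite leNgt; apply/negP => Qv.
  by apply: nv; exists v.
Qed.

Lemma quantile_continuity_ae {R : realType} (H : R -> R) :
  tail_function H ->
  {ae lebesgue_measure, forall u : R, 0 < u -> quantile_continuity_point H u}.
Proof.
move=> tH; have cH := quantile_discontinuity_countable tH.
exists [set u | 0 < u /\ ~ quantile_continuity_point H u]; split.
- exact: countable_measurable.
- exact: countable_lebesgue_measure0.
- by move=> u /= /not_implyP.
Qed.

(** * Probability laws on the half line *)

(** That [T] vanishes at infinity is continuity from above along the rays [`]k
    + 1, +oo[]. *)
Lemma tail_functionP {R : realType}
    (m : {measure set (measurableTypeR R) -> \bar R}) (T : R -> R) :
  (forall x, 0 < x -> m `]x, +oo[%classic = (T x)%:E) -> tail_function T.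
Proof.
move=> mT; split.
- by move=> x x0; rewrite -lee_fin -mT.
- move=> x y x0 xy; rewrite -lee_fin -!mT//; last exact: lt_le_trans xy.
  apply: le_measure; rewrite ?inE//=; try exact: measurable_itv.
  by move=> z /=; rewrite !in_itv/= !andbT; exact: le_lt_trans.
move=> u u0; pose D k : set R := `]k.+1%:R, +oo[%classic.
have mD k : measurable (D k : set (measurableTypeR R)) by exact: measurable_itv.
have DE : \bigcap_k D k = set0.
  rewrite -subset0 => x /(_ (Num.truncn `|x|) I).
  rewrite /D /= in_itv/= andbT => xx.
  have := lt_le_trans (truncnS_gt `|x|) (ltW (lt_le_trans xx (ler_norm x))).
  by rewrite ltxx.
have niD : nonincreasing_seq D.
  move=> p q pq; apply/subsetPset => x; rewrite /D /= !in_itv/= !andbT.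
  by apply: le_lt_trans; rewrite ler_nat.
have c : (m \o D) n @[n --> \oo] --> m set0.
  rewrite -DE; apply: nonincreasing_cvg_mu => //.
    by rewrite /D mT// ltry.
  by apply: bigcap_measurable => //; exists 0%N.
rewrite measure0 in c; apply: contrapT => nx.
have : (u%:E <= 0)%E.
  apply: (cvge_to_ge c); apply: nearW => n /=; rewrite /D mT// lee_fin leNgt.
  by apply/negP => Tu; apply: nx; exists n.+1%:R => //; exact: ltW.
by rewrite lee_fin leNgt u0.
Qed.

Lemma uniform_prob01 {R : realType} (A : set R) :
  measurable A -> A `<=` `]0, 1[ ->
  uniform_prob (@ltr01 R) A = lebesgue_measure A.
Proof.
move=> mA A01; rewrite /uniform_prob integral_uniform_pdf.
have AE : A `&` `[0, 1]%classic = A.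
  apply/setIidPl => x /A01 /=; rewrite !in_itv/= => /andP[/ltW -> /ltW ->//].
rewrite AE (eq_integral (cst 1%E)); last first.
  move=> x /set_mem /A01 /=; rewrite in_itv/= => /andP[x0 x1].
  by rewrite /uniform_pdf (ltW x0) (ltW x1) subr0 invr1.
by rewrite integral_cst// mul1e.
Qed.

(** The coupling determines the law on ]0, +oo[, hence on every set that does
    not contain 0; a set that contains 0 is handled through its complement. *)
Lemma law_quantile {R : realType} (lam : probability (measurableTypeR R) R)
    (T : R -> R) :
  lam `[0, +oo[%classic = 1%E ->
  (forall x, 0 < x -> lam `]x, +oo[%classic = (T x)%:E) ->
  forall A : set R, measurable A ->
    lam A = uniform_prob (@ltr01 R) (quantile T @^-1` A).
Proof.
move=> lam0 lamT; have tT := tail_functionP lamT.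
have mQ : measurable_fun (T := measurableTypeR R) (U := measurableTypeR R)
    [set: R] (quantile T) by exact: measurable_quantile.
have mQA (A : set (measurableTypeR R)) :
    measurable A -> measurable (quantile T @^-1` A : set (measurableTypeR R)).
  by move=> mA; rewrite -[X in measurable X]setTI; exact: mQ.
(* On sets of positive numbers the relevant levels lie in ]0, 1[, since the
   tails of [lam] are at most 1. *)
have pos (A : set (measurableTypeR R)) : measurable A -> A `<=` `]0, +oo[ ->
    lam A = uniform_prob (@ltr01 R) (quantile T @^-1` A).
  move=> mA A0; rewrite (quantile_coupling tT lamT)// uniform_prob01//.
    exact: mQA.
  move=> u /A0; rewrite /= !in_itv/= andbT => Qu.
  have u0 : 0 < u.
    by rewrite ltNge; apply: contraTN Qu => u0; rewrite quantile_le0// ltxx.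
  rewrite u0/= ltNge; apply: contraTN Qu => u1.
  rewrite -leNgt; apply/ler_addgt0Pl => e e0; rewrite addr0.
  apply: quantile_le => //; apply: le_trans u1.
  by rewrite -lee_fin -lamT// probability_le1.
have lamN : lam (~` `[0, +oo[%classic) = 0%E.
  by rewrite probability_setC ?lam0 ?subee//; exact: measurable_itv.
have nopos (A : set (measurableTypeR R)) : measurable A -> ~ A 0 ->
    lam A = uniform_prob (@ltr01 R) (quantile T @^-1` A).
  move=> mA A0.
  have mA0 : measurable (A `&` `]0, +oo[%classic : set (measurableTypeR R)).
    by apply: measurableI => //; exact: measurable_itv.
  have -> : quantile T @^-1` A = quantile T @^-1` (A `&` `]0, +oo[%classic).
    apply/seteqP; split => u /=; last by case.
    move=> AQ; split => //; rewrite in_itv/= andbT lt_neqAle quantile_ge0 andbT.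
    by apply/eqP => Q0; apply: A0; rewrite Q0.
  rewrite -pos//.
  rewrite -[in LHS](setUIDK A `]0, +oo[%classic) measureU//; last 2 first.
  - by apply: measurableD => //; exact: measurable_itv.
  - by apply/seteqP; split => // x [] [_ ?] [].
  rewrite [X in (_ + X)%E](_ : _ = 0%E) ?adde0//.
  apply: (@subset_measure0 _ _ _ lam _ (~` `[0, +oo[%classic)).
  - by apply: measurableD => //; exact: measurable_itv.
  - by apply: measurableC; exact: measurable_itv.
  - move=> x [Ax]; rewrite /= !in_itv/= !andbT => /negP nx x0; apply: A0.
    suff <- : x = 0 by [].
    by apply/eqP; rewrite eq_le x0 andbT leNgt.
  - exact: lamN.
move=> A mA; have [A0|] := pselect (A 0); last exact: nopos.
have mCA := measurableC mA.
have onemI (a b : \bar R) : a \is a fin_num -> b \is a fin_num ->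
    (1 - a = 1 - b -> a = b)%E.
  by case: a b => [a| |] [b| |]// _ _; rewrite -!EFinB => -[ab]; congr EFin; lra.
apply: onemI; first exact: fin_num_measure.
  by apply: fin_num_measure; exact: mQA.
rewrite -!probability_setC//; last exact: mQA.
by rewrite nopos.
Qed.

Lemma integrable_bounded {R : realType} {d} {T : measurableType d}
    (P : {finite_measure set T -> \bar R}) (f : T -> R) K :
  measurable_fun [set: T] f -> (forall x, `|f x| <= K) ->
  P.-integrable [set: T] (EFin \o f).
Proof.
move=> mf fK; apply: (@le_integrable _ _ _ _ _ _ _ (cst K%:E)) => //.
- exact/measurable_EFinP.
- by move=> u _ /=; rewrite lee_fin (le_trans (fK _))// ler_norm.
- exact: finite_measure_integrable_cst.
Qed.

Lemma integral_law_quantile {R : realType}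
    (lam : probability (measurableTypeR R) R) (T : R -> R) (f : R -> R) K :
  lam `[0, +oo[%classic = 1%E ->
  (forall x, 0 < x -> lam `]x, +oo[%classic = (T x)%:E) ->
  measurable_fun [set: R] f -> (forall x, `|f x| <= K) ->
  (\int[lam]_x (f x)%:E =
   \int[uniform_prob (@ltr01 R)]_u (f (quantile T u))%:E)%E.
Proof.
move=> lam0 lamT mf fK; have tT := tail_functionP lamT.
have mQ : measurable_fun (T := measurableTypeR R) (U := measurableTypeR R)
    [set: R] (quantile T) by exact: measurable_quantile.
pose mphi := isMeasurableFun.Build _ _ _ _ _ mQ.
pose Q : {mfun (measurableTypeR R) >-> (measurableTypeR R)} :=
  HB.pack (quantile T) mphi.
transitivity (\int[pushforward (uniform_prob (@ltr01 R)) Q]_x (f x)%:E)%E.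
  by apply: eq_measure_integral => A mA _; exact: law_quantile.
rewrite integral_pushforward//=; first exact/measurable_EFinP.
rewrite preimage_setT.
apply: (@integrable_bounded _ _ _ _ (f \o Q) K).
  by apply: measurableT_comp.
by move=> u; exact: fK.
Qed.

(** * A double exponential approximation of indicators *)

Lemma bernoulli_le {R : realType} (x : R) k :
  0 <= x <= 1 -> 1 - k%:R * x <= (1 - x) ^+ k.
Proof.
move=> /andP[x0 x1]; elim: k => [|k ih]; first by rewrite mul0r subr0 expr0.
rewrite exprS; apply: (@le_trans _ _ ((1 - x) * (1 - k%:R * x))).
  rewrite -natr1 -subr_ge0.
  rewrite [leRHS](_ : _ = k%:R * x ^+ 2); last by ring.
  by rewrite mulr_ge0// sqr_ge0.
by rewrite ler_wpM2l// subr_ge0.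
Qed.

Lemma expR_onem_le {R : realType} (x : R) k :
  x <= 1 -> (1 - x) ^+ k <= expR (- (k%:R * x)).
Proof.
move=> x1; rewrite -mulrN mulrC expRM_natr lerXn2r ?nnegrE ?subr_ge0 ?expR_ge0//.
exact: expR_ge1Dx.
Qed.

(** If [k] is close to [expR (m * r)] with [s < r < t], then [(1 - expR (- (m
    * y))) ^+ k] is close to [expR (- expR (m * (r - y)))], which tends to 0
    for [y < r] and to 1 for [y > r] as [m] grows. Being a polynomial in [expR
    (- (m * y))], it has an integral that is a combination of values of the
    Laplace transform. *)
Lemma double_exponential_step {R : realType} (s t e : R) :
  0 <= s -> s < t -> 0 < e -> exists m k : nat,
    (forall y, 0 <= y -> t <= y -> 1 - e <= (1 - expR (- (m%:R * y))) ^+ k) /\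
    (forall y, 0 <= y -> y <= s -> (1 - expR (- (m%:R * y))) ^+ k <= e).
Proof.
move=> s0 st e0.
pose r := (s + t) / 2; pose dl := (t - s) / 2.
have dl0 : 0 < dl by rewrite divr_gt0// subr_gt0.
(* With this [m], [expR (m * dl)] is at least [2 / e]; [k] rounds [expR (m *
   r)] up. *)
pose m := (Num.truncn (2 / e / dl)).+1; pose k := (Num.truncn (expR (m%:R * r))).+1.
have md : 2 / e <= expR (m%:R * dl).
  apply: (@le_trans _ _ (m%:R * dl)); last by apply: le_trans (expR_ge1Dx _); lra.
  by rewrite -ler_pdivrMr// ltW// truncnS_gt.
have em : 2 * expR (- (m%:R * dl)) <= e.
  by rewrite expRN ler_pdivrMr ?expR_gt0// mulrC -ler_pdivrMr.
have klo : expR (m%:R * r) <= k%:R by rewrite ltW// truncnS_gt.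
have khi : k%:R <= 2 * expR (m%:R * r).
  have e1 : 1 <= expR (m%:R * r).
    rewrite -expR0 ler_expR mulr_ge0//; rewrite divr_ge0//.
    by rewrite addr_ge0// ltW// (le_lt_trans s0 st).
  have : (Num.truncn (expR (m%:R * r)))%:R <= expR (m%:R * r).
    by rewrite truncn_le expR_ge0.
  by rewrite /k -natr1; lra.
have x1 (y : R) : 0 <= y -> expR (- (m%:R * y)) <= 1.
  by move=> y0; rewrite -expR0 ler_expR oppr_le0 mulr_ge0.
exists m, k; split=> y y0 ys.
- apply: (@le_trans _ _ (1 - k%:R * expR (- (m%:R * y)))); last first.
    by apply: bernoulli_le; rewrite expR_ge0 x1.
  rewrite lerD2l lerN2; apply: le_trans em.
  have -> : - (m%:R * dl) = m%:R * r - m%:R * t by rewrite /r /dl; field.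
  rewrite expRD mulrA ler_pM ?expR_ge0// ler_expR lerN2.
  by rewrite ler_wpM2l.
- apply: (le_trans (expR_onem_le k (x1 _ y0))).
  have kx : 2 / e <= k%:R * expR (- (m%:R * y)).
    apply: (le_trans md).
    have -> : m%:R * dl = m%:R * r - m%:R * s by rewrite /r /dl; field.
    by rewrite expRD ler_pM ?expR_ge0// ler_expR lerN2 ler_wpM2l.
  rewrite expRN -[leRHS]invrK lef_pV2 ?posrE ?expR_gt0 ?invr_gt0//.
  apply: le_trans (expR_ge1Dx _).
  have : 0 < e^-1 by rewrite invr_gt0.
  by move: kx; lra.
Qed.

(** * Continuity theorem for Laplace transforms *)

Lemma ge0_integral_pos {R : realType} (lam : probability (measurableTypeR R) R)
    (f : R -> \bar R) : lam `[0, +oo[%classic = 1%E ->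
  measurable_fun [set: R] f -> (forall x, 0 <= f x)%E ->
  (\int[lam]_x f x = \int[lam]_(x in `[0%R, +oo[) f x)%E.
Proof.
move=> lam0 mf f0.
have mpos : measurable (`[0, +oo[%classic : set (measurableTypeR R)).
  exact: measurable_itv.
have lamN : lam (~` `[0, +oo[%classic) = 0%E.
  by rewrite probability_setC// lam0 subee.
rewrite (@ge0_negligible_integral _ (measurableTypeR R) _ lam setT (~` `[0%R, +oo[%classic))//.
  by rewrite setTD setCK.
exact: measurableC.
Qed.

Section laplace_continuity.
Context {R : realType}.
Variables (lam : nat -> probability (measurableTypeR R) R) (phi : R -> R).
Hypothesis lam0 : forall n, lam n `[0, +oo[%classic = 1%E.
Hypothesis lam_phi : forall z, 0 <= z ->
  (\int[lam n]_(x in `[0%R, +oo[) (expR (- (z * x)))%:E)%E @[n --> \oo]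
    --> (phi z)%:E.
Hypothesis phi0 : forall e, 0 < e -> exists2 z, 0 < z & 1 - phi z < e.

(** Cutting [x] at 0 makes the exponential bounded on the whole line and does
    not affect integrals against laws on [[0, +oo[]. *)
Let v (z x : R) : R := expR (- (z * Num.max 0 x)).

Let mv z : measurable_fun [set: R] (v z).
Proof.
apply: measurableT_comp; first exact: measurable_expR.
apply: measurableT_comp; first exact: oppr_measurable.
by apply: measurable_funM => //; exact: measurable_maxr.
Qed.

Let v01 z x : 0 <= z -> 0 <= v z x <= 1.
Proof.
move=> z0; rewrite expR_ge0/= -expR0 ler_expR oppr_le0 mulr_ge0//.
by rewrite le_max lexx.
Qed.

Let vE z x : 0 <= x -> v z x = expR (- (z * x)).
Proof. by move=> x0; rewrite /v; congr (expR (- (_ * _))); exact/max_idPr. Qed.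

Let v_cvg z : 0 <= z ->
  (\int[lam n]_x (v z x)%:E)%E @[n --> \oo] --> (phi z)%:E.
Proof.
move=> z0; apply: cvg_trans (lam_phi z0); apply: near_eq_cvg; apply: nearW => n.
rewrite ge0_integral_pos//; last 2 first.
- by apply/measurable_EFinP; exact: mv.
- by move=> x; rewrite lee_fin expR_ge0.
by apply: eq_integral => x /[!inE]/=; rewrite in_itv/= andbT => /vE ->.
Qed.

Let w (z : R) k j x := (1 - v z x) ^+ k * v z x ^+ j.

Let mw z k j : measurable_fun [set: R] (w z k j).
Proof.
apply: measurable_funM; apply: measurable_funX => //.
by apply: measurable_funB.
Qed.

Let w01 z k j x : 0 <= z -> `|w z k j x| <= 1.
Proof.
move=> z0; have /andP[v0 v1] := v01 x z0.
have v0' : 0 <= 1 - v z x by rewrite subr_ge0.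
rewrite ger0_norm ?mulr_ge0 ?exprn_ge0// mulr_ile1 ?exprn_ge0//.
  by rewrite exprn_ile1// lerBlDr lerDl.
by rewrite exprn_ile1.
Qed.

(** The powers of [v z] are the [v] of the multiples of [z]; writing [(1 - v)
    ^+ k.+1] as a difference replaces a binomial expansion. *)
Let w_cvg z k j : 0 <= z ->
  exists l : R, (\int[lam n]_x (w z k j x)%:E)%E @[n --> \oo] --> l%:E.
Proof.
move=> z0; elim: k j => [|k ih] j.
  exists (phi (z *+ j)).
  have := v_cvg (mulrn_wge0 j z0); apply: cvg_trans; apply: near_eq_cvg.
  apply: nearW => n; apply: eq_integral => x _.
  by rewrite /w expr0 mul1r /v -expRM_natr mulNr mulr_natr mulrnAl.
have [l1 l1P] := ih j; have [l2 l2P] := ih j.+1.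
exists (l1 - l2).
rewrite EFinB; apply: cvg_trans (cvgeB _ l1P l2P) => //.
apply: near_eq_cvg; apply: nearW => n.
rewrite /= -integralB//; last 2 first.
- by apply: (@integrable_bounded _ _ _ (lam n) (w z k j) 1); [exact: mw|move=> x; exact: w01].
- by apply: (@integrable_bounded _ _ _ (lam n) (w z k j.+1) 1); [exact: mw|move=> x; exact: w01].
by apply: eq_integral => x _; rewrite -EFinB /w; congr EFin; rewrite !exprS; ring.
Qed.

Let T n x := fine (lam n `]x, +oo[%classic).

Let lamT n x : 0 < x -> lam n `]x, +oo[%classic = (T n x)%:E.
Proof. by rewrite /T fineK// fin_num_measure//; exact: measurable_itv. Qed.

Let tT n : tail_function (T n).
Proof. exact: tail_functionP (@lamT n). Qed.

Let integral_indic_add n (r c : R) : 0 <= c -> 0 < r ->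
  (\int[lam n]_x (\1_(`]r, +oo[%classic : set R) x + c)%:E = (T n r + c)%:E)%E.
Proof.
move=> c0 r0; under eq_integral do rewrite EFinD.
rewrite ge0_integralD//; last first.
  by apply/measurable_EFinP; exact: measurable_indic.
rewrite integral_indic// setIT integral_cst//.
rewrite [X in (X + _)%E](_ : _ = (T n r)%:E); last exact: lamT.
by rewrite [X in (_ * X)%E](_ : _ = 1%E) ?mule1//; exact: probability_setT.
Qed.

(** The integral of the approximate indicator of [x > t] lies between the
    tails at [t] and at [s], up to [e / 2]. *)
Let tails_squeeze s t e : 0 < s -> s < t -> 0 < e ->
  exists l, \forall n \near \oo, T n t <= l + e /\ l <= T n s + e.
Proof.
move=> s0 st e0; have e20 : 0 < e / 2 by rewrite divr_gt0.
have [m [k [hi lo]]] := double_exponential_step (ltW s0) st e20.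
have [l lP] := w_cvg k 0 (ler0n R m).
pose W n := fine (\int[lam n]_x (w m%:R k 0 x)%:E)%E.
have WE n : (\int[lam n]_x (w m%:R k 0 x)%:E)%E = (W n)%:E.
  rewrite /W fineK//; apply: integrable_fin_num => //.
  by apply: (@integrable_bounded _ _ _ (lam n) (w m%:R k 0) 1);
    [exact: mw|move=> x; exact: w01].
have wE x : w m%:R k 0 x = (1 - expR (- (m%:R * Num.max 0 x))) ^+ k.
  by rewrite /w expr0 mulr1.
have max0 x : 0 <= Num.max 0 x :> R by rewrite le_max lexx.
have w0 x : 0 <= w m%:R k 0 x.
  have /andP[_ v1] := v01 x (ler0n R m).
  by rewrite /w expr0 mulr1 exprn_ge0// subr_ge0.
have Wcvg : W n @[n --> \oo] --> l by exact: fine_cvg.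
exists l; move/cvgrPdist_le : Wcvg => /(_ _ e20); apply: filterS => n.
rewrite ler_distlC => /andP[Wlo Whi].
have mE : measurable_fun [set: measurableTypeR R] (fun x => (w m%:R k 0 x)%:E).
  by apply/measurable_EFinP; exact: mw.
split.
  apply: (@le_trans _ _ (W n + e / 2)); last by move: Whi; lra.
  have -> : T n t = T n t + 0 by rewrite addr0.
  have t0 := lt_trans s0 st.
  rewrite -lee_fin -integral_indic_add// EFinD -WE.
  have <- : (\int[lam n]_x (cst (e / 2)%:E) x = (e / 2)%:E)%E.
    rewrite integral_cst// [X in (_ * X)%E](_ : _ = 1%E) ?mule1//.
    exact: probability_setT.
  rewrite -ge0_integralD//; last 2 first.
  - by move=> x _; rewrite lee_fin.
  - by move=> x _; rewrite lee_fin ltW.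
  apply: ge0_le_integral => //.
  - apply/measurable_EFinP; apply: measurable_funD; first exact: measurable_indic.
    exact: measurable_cst.
  - exact: emeasurable_funD.
  move=> x _; rewrite -EFinD lee_fin addr0 indicE mem_setE in_itv/= andbT.
  case: ltP => [tx|_]; last by rewrite addr_ge0// ltW.
  rewrite wE -lerBlDr; apply: hi => //.
  by rewrite le_max (ltW tx) orbT.
apply: (@le_trans _ _ (W n + e / 2)); first by move: Wlo; lra.
suff : W n <= T n s + e / 2 by lra.
rewrite -lee_fin -WE -integral_indic_add//; last exact: ltW.
apply: ge0_le_integral => //.
- by move=> x _; rewrite lee_fin.
- apply/measurable_EFinP; apply: measurable_funD; first exact: measurable_indic.
  exact: measurable_cst.
move=> x _; rewrite lee_fin indicE mem_setE in_itv/= andbT.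
case: ltP => [sx|xs].
  apply: (@le_trans _ _ 1); last by rewrite lerDl ltW.
  by rewrite (le_trans (ler_norm _))// w01.
by rewrite add0r wE lo// ge_max (ltW s0).
Qed.

Let T01 n x : 0 < x -> 0 <= T n x <= 1.
Proof.
move=> x0; rewrite -!lee_fin -!lamT// measure_ge0 probability_le1//.
Qed.

Let S t := [set r | \forall n \near \oo, T n t <= r].

Let S1 t : 0 < t -> S t 1.
Proof. by move=> t0; apply: nearW => n; case/andP: (T01 n t0). Qed.

Let S_ge0 t r : 0 < t -> S t r -> 0 <= r.
Proof.
move=> t0 [N _ /(_ N)/=]; rewrite leqnn => /(_ isT).
by apply: le_trans; case/andP: (T01 N t0).
Qed.

Let S_inf t : 0 < t -> has_inf (S t).
Proof.
move=> t0; split; first by exists 1; exact: S1.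
by exists 0 => r; exact: S_ge0.
Qed.

(** The upper limit of the tails. It need not be the tail of the limit law,
    only have the same quantiles up to countably many levels. *)
Let H t := inf (S t).

Let T_le_H t e : 0 < t -> 0 < e -> \forall n \near \oo, T n t <= H t + e.
Proof.
move=> t0 e0; have [r Sr re] := inf_adherent e0 (S_inf t0).
by apply: filterS Sr => n Tr; apply: (le_trans Tr); exact: ltW.
Qed.

Let H_le t r : 0 < t -> S t r -> H t <= r.
Proof. by move=> t0; apply: ge_inf; case: (S_inf t0). Qed.

Let H_nonincreasing s t : 0 < s -> s <= t -> H t <= H s.
Proof.
move=> s0 st; apply: lb_le_inf; first by case: (S_inf s0).
move=> r Sr; apply: H_le; first exact: lt_le_trans st.
apply: filterS Sr => n; apply: le_trans; exact: (tail_le (tT n)).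
Qed.

(** Tightness. By Markov's inequality, [(1 - expR (- 1)) * T n z^-1] is at
    most the integral of [1 - expR (- (z * x))], which tends to [1 - phi z].
    *)
Let T_small u : 0 < u -> exists2 t, 0 < t & S t u.
Proof.
move=> u0; pose c : R := 1 - expR (- 1).
have c0 : 0 < c by rewrite subr_gt0 -[ltRHS]expR0 ltr_expR ltrN10.
have [z z0 phiz] := phi0 (mulr_gt0 u0 c0).
exists z^-1; first by rewrite invr_gt0.
have z1 : 0 < z^-1 by rewrite invr_gt0.
have [l lP] := w_cvg 1 0 (ltW z0).
have W0 x : 0 <= w z 1 0 x.
  have /andP[_ v1] := v01 x (ltW z0).
  by rewrite /w expr0 mulr1 expr1 subr_ge0.
have Tw n : ((c * T n z^-1)%:E <= \int[lam n]_x (w z 1 0 x)%:E)%E.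
  have -> : ((c * T n z^-1)%:E =
      \int[lam n]_x (c%:E * (\1_(`]z^-1, +oo[%classic : set R) x)%:E))%E.
    rewrite ge0_integralZl//; last 2 first.
    - by apply/measurable_EFinP; exact: measurable_indic.
    - by rewrite lee_fin ltW.
    by rewrite integral_indic// setIT EFinM; congr (_ * _)%E; rewrite -lamT.
  apply: ge0_le_integral => //.
  - by move=> x _; rewrite mule_ge0// lee_fin// ltW.
  - by apply/measurable_EFinP; apply: measurable_funM => //; exact: measurable_indic.
  - by apply/measurable_EFinP; exact: mw.
  move=> x _; rewrite -EFinM lee_fin indicE mem_setE in_itv/= andbT.
  case: ltP => [zx|_]; last by rewrite mulr0 W0.
  rewrite mulr1 /w expr0 mulr1 expr1 lerD2l lerN2 ler_expR lerN2.
  by rewrite -ler_pdivrMl// mulr1 le_max (ltW zx) orbT.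
have c1 : (\int[lam n]_x (w z 1 0 x)%:E)%E @[n --> \oo] --> (1 - phi z)%:E.
  have := v_cvg (ltW z0) => vc.
  rewrite EFinB; apply: cvg_trans (cvgeB _ (cvg_cst 1%E) vc) => //.
  apply: near_eq_cvg; apply: nearW => n.
  have <- : (\int[lam n]_x (cst 1%:E) x = 1%E)%E.
    rewrite integral_cst// mul1e; exact: probability_setT.
  rewrite -integralB//.
  - by apply: eq_integral => x _; rewrite -EFinB /w expr1 expr0 mulr1.
  - exact: finite_measure_integrable_cst.
  - apply: (@integrable_bounded _ _ _ (lam n) (v z) 1); first exact: mv.
    by move=> x; have /andP[vx0 vx1] := v01 x (ltW z0); rewrite ger0_norm.
have : \forall n \near \oo, (\int[lam n]_x (w z 1 0 x)%:E < (u * c)%:E)%E.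
  have phiE : ((1 - phi z)%:E < (u * c)%:E)%E by rewrite lte_fin.
  exact: (c1 _ (open_ereal_lt' phiE)).
apply: filterS => n Wu; have := le_lt_trans (Tw n) Wu.
by rewrite lte_fin mulrC ltr_pM2r// => /ltW.
Qed.

Let tH : tail_function H.
Proof.
split; last by move=> u /T_small[t t0 St]; exists t => //; exact: H_le.
- move=> x x0; apply: lb_le_inf; first by case: (S_inf x0).
  by move=> r; exact: S_ge0.
- exact: H_nonincreasing.
Qed.

Let quantile_T_cvg u : quantile_continuity_point H u ->
  quantile (T n) u @[n --> \oo] --> quantile H u.
Proof.
apply: quantile_cvg => // s t e s0 st e0.
  have t0 := lt_trans s0 st.
  apply: filterS (T_le_H t0 e0) => n Tn; apply: (le_trans Tn).
  by rewrite lerD2r; apply: H_nonincreasing => //; exact: ltW.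
have e20 : 0 < e / 2 by rewrite divr_gt0.
have t0 := lt_trans s0 st.
have [l lP] := tails_squeeze s0 st e20.
have Hl : H t <= l + e / 2.
  by apply: H_le => //; apply: filterS lP => n [].
apply: filterS lP => n [_ lT]; move: Hl lT; lra.
Qed.

Let Q : {mfun (measurableTypeR R) >-> (measurableTypeR R)} :=
  HB.pack (quantile H) (isMeasurableFun.Build _ _
    (measurableTypeR R) (measurableTypeR R) (quantile H) (measurable_quantile tH)).

Let nu : probability (measurableTypeR R) R :=
  distribution (uniform_prob (@ltr01 R)) Q.

Let nu0 : nu `[0, +oo[%classic = 1%E.
Proof.
rewrite /nu /= /distribution /pushforward [X in uniform_prob _ X](_ : _ = setT).
  exact: probability_setT.
by apply/seteqP; split => // u _; rewrite /= in_itv/= quantile_ge0.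
Qed.

(** Written on the uniform probability space, the integrals have converging
    bounded integrands. *)
Let nu_cvg (f : R -> R) : continuous f -> (exists K, forall x, `|f x| <= K) ->
  (\int[lam n]_x (f x)%:E)%E @[n --> \oo] --> (\int[nu]_x (f x)%:E)%E.
Proof.
move=> cf [K fK].
have mf : measurable_fun [set: R] f by exact: continuous_measurable_fun.
pose U := uniform_prob (@ltr01 R).
have -> : (\int[nu]_x (f x)%:E = \int[U]_u (f (quantile H u))%:E)%E.
  rewrite /nu integral_distribution//; first exact/measurable_EFinP.
  apply: (@integrable_bounded _ _ _ _ (f \o Q) K); last by move=> u; exact: fK.
  exact: (measurableT_comp mf (measurable_quantile tH)).
rewrite (_ : (fun n => _) = fun n => (\int[U]_u (f (quantile (T n) u))%:E)%E); last first.
  by apply/funext => n; apply: integral_law_quantile fK => //; exact: lamT.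
have mfQ G : tail_function G -> measurable_fun [set: R] (fun u => (f (quantile G u))%:E).
  move=> tG; apply/measurable_EFinP; apply: measurableT_comp => //.
  exact: measurable_quantile.
have [] := @dominated_convergence _ _ _ U setT measurableT
  (fun n u => (f (quantile (T n) u))%:E) (fun u => (f (quantile H u))%:E)
  (cst K%:E) (fun n => mfQ _ (tT n)) (mfQ _ tH).
- have [N [mN N0 NP]] := quantile_continuity_ae tH.
  have m01 : measurable (`]0, 1[%classic : set (measurableTypeR R)).
    exact: measurable_itv.
  have mN1 : measurable (N `&` `]0, 1[%classic : set (measurableTypeR R)).
    exact: measurableI.
  have U1 : U (N `&` `]0, 1[%classic) = 0%E.
    rewrite /U uniform_prob01//.
    exact: (@subset_measure0 _ _ _ lebesgue_measure _ N).
  have U2 : U (~` `]0, 1[%classic) = 0%E.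
    rewrite /U probability_setC// [X in (1 - X)%E](_ : _ = 1%E) ?subee//.
    transitivity (lebesgue_measure (`]0, 1[%classic : set R)).
      exact: uniform_prob01.
    by rewrite lebesgue_measure_itv/= lte_fin ltr01 oppr0 adde0.
  exists ((N `&` `]0, 1[%classic) `|` (~` `]0, 1[%classic)); split => //.
  - by apply: measurableU => //; exact: measurableC.
  - by apply: null_set_setU => //; exact: measurableC.
  - move=> u /= nu_u; have [u01|] := pselect (`]0, 1[%classic u); last by right.
    left; split=> //; apply: NP => /= Cu; apply: nu_u => _.
    have u0 : 0 < u by move: u01; rewrite /= in_itv/= => /andP[].
    apply/fine_cvgP; split; first exact: nearW.
    exact: (@cvg_comp _ _ _ _ f _ _ _ (quantile_T_cvg (Cu u0)) (cf _)).
- exact: finite_measure_integrable_cst.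
- by apply: aeW => u n _; rewrite /= lee_fin.
- by [].
Qed.

(** The limit [phi] is not assumed to be a Laplace transform: values close to
    1 near 0 prevent mass from escaping to infinity, and the limit law is
    built from the limits of the quantiles. *)
Lemma laplace_continuity_theorem : exists nu : probability (measurableTypeR R) R,
  [/\ nu `[0, +oo[%classic = 1%E,
    forall z, 0 <= z ->
      (\int[nu]_(x in `[0%R, +oo[) (expR (- (z * x)))%:E = (phi z)%:E)%E &
    forall f : R -> R, continuous f -> (exists K, forall x, `|f x| <= K) ->
      (\int[lam n]_x (f x)%:E)%E @[n --> \oo] --> (\int[nu]_x (f x)%:E)%E].
Proof.
exists nu; split; [exact: nu0| |exact: nu_cvg].
move=> z z0; have cv : continuous (v z).
  move=> x; apply: continuous_comp; last exact: continuous_expR.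
  apply: continuousN; apply: continuousM; first exact: cvg_cst.
  by apply: continuous_max; [exact: cvg_cst|exact: cvg_id].
have vb : exists K, forall x, `|v z x| <= K.
  by exists 1 => x; have /andP[v0 v1] := v01 x z0; rewrite ger0_norm.
have <- : (\int[nu]_x (v z x)%:E = (phi z)%:E)%E.
  exact: (cvg_unique _ (nu_cvg cv vb) (v_cvg z0)).
rewrite ge0_integral_pos//; last 2 first.
- by apply/measurable_EFinP; exact: mv.
- by move=> x; rewrite lee_fin expR_ge0.
by apply: eq_integral => x /[!inE]/=; rewrite in_itv/= andbT => /vE ->.
Qed.

End laplace_continuity.

(** * Powers, compound limits and a Potter bound *)

Lemma continuous_powR {R : realType} (r x : R) :
  0 < x -> {for x, continuous (fun y : R => y `^ r)}.
Proof.
move=> x0; apply: differentiable_continuous; apply/derivable1_diffP.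
by have [] := is_derive1_powR r x0.
Qed.

Lemma ler_powRN {R : realType} (r x y : R) :
  0 <= r -> 0 < x -> x <= y -> y `^ (- r) <= x `^ (- r).
Proof.
move=> r0 x0 xy; have y0 := lt_le_trans x0 xy.
rewrite !powRN lef_pV2 ?posrE ?powR_gt0//.
by rewrite ge0_ler_powR ?nnegrE// ltW.
Qed.

Lemma powRNK {R : realType} (r x : R) : 0 < r -> 0 < x ->
  (x `^ (- r^-1)) `^ (- r) = x.
Proof.
move=> r0 x0; rewrite -powRrM mulrNN mulVf ?gt_eqF//.
by rewrite powRr1// ltW.
Qed.

(** A squeeze between the powers of [expR (- y / (1 - y)) <= 1 - y <= expR (-
    y)]. *)
Lemma cvg_onem_expR {R : realType} (y : nat -> R) (c : R) :
  (\forall n \near \oo, 0 <= y n) -> n%:R * y n @[n --> \oo] --> c ->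
  (1 - y n) ^+ n @[n --> \oo] --> expR (- c).
Proof.
move=> y0 yc.
have inv0 : n%:R^-1 @[n --> \oo] --> (0 : R).
  by apply/gtr0_cvgV0; [near=> n; rewrite ltr0n; near: n; exact: nbhs_infty_gt|exact: cvgr_idn].
have y_cvg0 : y n @[n --> \oo] --> (0 : R).
  rewrite -(mulr0 c); apply: cvg_trans (cvgM yc inv0); apply: near_eq_cvg.
  near=> n; rewrite /= mulrAC divff ?mul1r//.
  by rewrite pnatr_eq0 -lt0n; near: n; exact: nbhs_infty_gt.
have ylt : \forall n \near \oo, y n < 1 by apply: (cvgr_lt _ y_cvg0); exact: ltr01.
have lo : expR (- (n%:R * y n / (1 - y n))) @[n --> \oo] --> expR (- c).
  apply: continuous_cvg; first exact: continuous_expR.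
  apply: cvgN; rewrite -[c in X in _ --> X]divr1; apply: cvgM => //.
  apply: cvgV; first by rewrite oner_eq0.
  by rewrite -[1 in X in _ --> X]subr0; apply: cvgB => //; exact: cvg_cst.
have hi : expR (- (n%:R * y n)) @[n --> \oo] --> expR (- c).
  by apply: continuous_cvg; [exact: continuous_expR|exact: cvgN].
apply: squeeze_cvgr lo hi; near=> n.
have yn0 : 0 <= y n by near: n.
have yn1 : y n < 1 by near: n.
have yn1' : 0 < 1 - y n by rewrite subr_gt0.
apply/andP; split; last by apply: expR_onem_le; exact: ltW.
have -> : - (n%:R * y n / (1 - y n)) = - (y n / (1 - y n)) * n%:R by ring.
rewrite expRM_natr lerXn2r ?nnegrE ?expR_ge0 ?(ltW yn1')//.
rewrite expRN -[leRHS]invrK lef_pV2 ?posrE ?expR_gt0 ?invr_gt0//.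
apply: le_trans (expR_ge1Dx _).
rewrite [leLHS](_ : _ = 1 + y n / (1 - y n))//.
by field; rewrite gt_eqF.
Unshelve. all: by end_near. Qed.

Lemma ltr_powR_exp {R : realType} (x r s : R) :
  1 < x -> r < s -> x `^ r < x `^ s.
Proof.
move=> x1 rs; have x0 : 0 < x := lt_trans ltr01 x1.
have -> : s = r + (s - r) by rewrite addrC subrK.
rewrite powRD; last by rewrite (gt_eqF x0) implybT.
have p1 : 1 `^ (s - r) = 1 :> R by rewrite powR1.
rewrite ltr_pMr ?powR_gt0// -[ltLHS]p1.
by apply: gt0_ltr_powR; rewrite ?subr_gt0 ?nnegrE// ltW.
Qed.

(** Beyond some [t0], halving the argument multiplies [F] by at most [2 `^
    a'], so going down from [t] to [x * t] costs [x `^ (- a')] up to a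
    constant. When [x * t] is below [t0], [F] is at most 1, which is
    controlled by the bound at the point [t0]. *)
Lemma potter_bound {R : realType} (F : R -> R) (a a' : R) :
  tail_function F -> (forall x, 0 < x -> 0 < F x <= 1) -> 0 < a' -> a < a' ->
  F (2^-1 * t) / F t @[t --> +oo] --> 2 `^ a ->
  exists C t0, [/\ 0 < C, 0 < t0 &
    forall t x, t0 <= t -> 0 < x <= 1 -> F (x * t) <= C * x `^ (- a') * F t].
Proof.
move=> tF F01 a'0 aa' Fcvg.
have pw : 2 `^ a < 2 `^ a' by apply: ltr_powR_exp => //; rewrite ltr1n.
have [M [_ MP]] := cvgr_lt _ Fcvg _ pw.
pose t0 := Num.max (M + 1) 1.
have t00 : 0 < t0 by rewrite lt_max ltr01 orbT.
have half t : t0 <= t -> F (2^-1 * t) <= 2 `^ a' * F t.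
  move=> tt; have t_gt0 := lt_le_trans t00 tt.
  have /andP[Ft0 _] := F01 _ t_gt0.
  rewrite -ler_pdivrMr// ltW//; apply: MP.
  by apply: lt_le_trans tt; rewrite lt_max ltrDl ltr01.
have p0 : 0 < 2 `^ a' :> R by rewrite powR_gt0.
have far k t x : t0 <= x * t -> 0 < x <= 1 -> 2^-1 ^+ k <= x ->
    F (x * t) <= 2 `^ a' * x `^ (- a') * F t.
  move=> xt0 /andP[x0 x1]; have t_gt0 : 0 < t.
    by rewrite -(pmulr_rgt0 _ x0); exact: lt_le_trans xt0.
  have tt : t0 <= t by apply: le_trans xt0 _; rewrite ler_piMl// ltW.
  have /andP[Ft0 _] := F01 _ t_gt0.
  elim: k x xt0 x0 x1 => [|k ih] x xt x0 x1 kx.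
    have -> : x = 1 by apply/eqP; rewrite eq_le x1 -(expr0 (2^-1 : R)).
    rewrite mul1r powR1 mulr1 ler_pMl// -[leLHS](powRr0 (2 : R)).
    by rewrite ltW// ltr_powR_exp// ltr1n.
  have x20 : 0 < 2 * x by rewrite mulr_gt0.
  have x2t : t0 <= 2 * x * t.
    by apply: (le_trans xt); rewrite -mulrA ler_peMl ?ler1n// ltW// mulr_gt0.
  have step : F (x * t) <= 2 `^ a' * F (2 * x * t).
    by have := half _ x2t; rewrite mulrA mulrA mulVf ?mul1r.
  apply: (le_trans step); rewrite -[leRHS]mulrA ler_pM2l//.
  have [x21|x21] := leP (2 * x) 1.
    have kx2 : 2^-1 ^+ k <= 2 * x by rewrite -ler_pdivrMl// -exprS.
    apply: (le_trans (ih _ x2t x20 x21 kx2)).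
    rewrite powRM ?(ltW x0)// mulrA -powRD ?subrr ?powRr0 ?mul1r//.
    by rewrite eqxx/= pnatr_eq0.
  have xa : 1 <= x `^ (- a').
    have p1 : 1 `^ (- a') = 1 :> R by rewrite powR1.
    by rewrite -[leLHS]p1 ler_powRN// ltW.
  apply: (@le_trans _ _ (F t)); last by rewrite ler_peMl// ltW.
  by apply: tail_le => //; rewrite ler_peMl ?ltW.
have /andP[F0 F1] := F01 _ t00.
exists (2 `^ a' / F t0), t0; split=> //; first by rewrite divr_gt0.
move=> t x tt /andP[x0 x1]; have t_gt0 := lt_le_trans t00 tt.
have /andP[Ft0 _] := F01 _ t_gt0.
have far' y : t0 <= y * t -> 0 < y <= 1 ->
    F (y * t) <= 2 `^ a' * y `^ (- a') * F t.
  move=> yt /andP[y0 y1]; apply: (far (Num.truncn y^-1).+1) => //.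
    by rewrite y0.
  rewrite exprVn -[leRHS]invrK lef_pV2 ?posrE ?invr_gt0 ?exprn_gt0//.
  apply: (@le_trans _ _ (Num.truncn y^-1).+1%:R); first by rewrite ltW// truncnS_gt.
  by rewrite -natrX ler_nat ltnW// ltn_expl.
have [xt|xt] := leP t0 (x * t).
  apply: (le_trans (far' _ xt _)); first by rewrite x0.
  rewrite ler_pM2r// ler_pM2r ?powR_gt0// ler_pdivlMr//.
  by rewrite ler_piMr// ltW.
have xt0 : x <= t0 / t by rewrite ler_pdivlMr// ltW.
have := far' (t0 / t); rewrite divfK ?gt_eqF// => /(_ (lexx _)).
rewrite divr_gt0// ler_pdivrMr// mul1r => /(_ tt) H.
have /andP[_ Fxt1] := F01 _ (mulr_gt0 x0 t_gt0).
apply: (le_trans Fxt1).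
rewrite -!mulrA mulrCA ler_pdivlMl// mulr1 mulrA.
apply: (le_trans H); rewrite ler_pM2r// ler_pM2l//.
by apply: ler_powRN => //; exact: ltW.
Qed.

(** * Norming sequences *)

Section norming_sequence.
Context {R : realType}.
Variables (F V : R -> R) (a : R).
Hypothesis a01 : 0 < a < 1.
Hypothesis tF : tail_function F.
Hypothesis F01 : forall x, 0 < x -> 0 < F x <= 1.
Hypothesis F_rv : forall x, 0 < x -> F (x * t) / F t @[t --> +oo] --> x `^ (- a).
Hypothesis VF : forall t, 0 < t -> V t = (F t)^-1.

Let b n := gen_inverse V n%:R.
Let S n := [set s | 0 < s /\ n%:R < V s].

Let F_gt0 x : 0 < x -> 0 < F x.
Proof. by move=> /F01 /andP[]. Qed.

Let S_inf n : has_inf (S n).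
Proof.
split; last by exists 0 => s [/ltW].
have n0 : 0 < (n.+1%:R)^-1 :> R by rewrite invr_gt0.
have [x x0 Fx] := tail_small tF n0; exists x; split => //.
rewrite VF// (@lt_le_trans _ _ n.+1%:R) ?ltr_nat//.
by rewrite -[leLHS]invrK lef_pV2 ?posrE ?F_gt0.
Qed.

Let V_le s t : 0 < s -> s <= t -> V s <= V t.
Proof.
move=> s0 st; have t0 := lt_le_trans s0 st.
by rewrite !VF// lef_pV2 ?posrE ?F_gt0// (tail_le tF).
Qed.

Let below n s : 0 < s -> s < b n -> 1 <= n%:R * F s.
Proof.
move=> s0 sb; rewrite -ler_pdivrMr ?F_gt0// mul1r -VF// leNgt.
apply/negP => nV; move: sb; rewrite ltNge => /negP; apply.
by apply: ge_inf => //; case: (S_inf n).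
Qed.

Let above n s : b n < s -> n%:R * F s <= 1.
Proof.
move=> bs; have [r [r0 Vr] rs] := inf_lt (S_inf n).1 bs.
have s0 := lt_trans r0 rs.
rewrite -ler_pdivlMr ?F_gt0// mul1r -VF// ltW//.
by apply: (lt_le_trans Vr); apply: V_le => //; exact: ltW.
Qed.

Lemma gen_inverse_cvgy : b n @[n --> \oo] --> +oo.
Proof.
apply/cvgryPge => A; pose B := Num.max A 1.
have B0 : 0 < B by rewrite lt_max ltr01 orbT.
near=> n; apply: (@le_trans _ _ B); first by rewrite le_max lexx.
apply: lb_le_inf; first by case: (S_inf n).
move=> s [s0 Vs]; rewrite leNgt; apply/negP => sB.
have := V_le s0 (ltW sB); rewrite leNgt => /negP; apply; apply: le_lt_trans Vs.
by near: n; exact: nbhs_infty_ger.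
Unshelve. all: by end_near. Qed.

Let b_gt0 : \forall n \near \oo, 0 < b n.
Proof. by move/cvgryPgt : gen_inverse_cvgy; apply. Qed.

Let ratio x y : 0 < x -> 0 < y ->
  F (x * b n) / F (y * b n) @[n --> \oo] --> x `^ (- a) / y `^ (- a).
Proof.
move=> x0 y0.
have cx := cvg_comp _ _ gen_inverse_cvgy (F_rv x0).
have cy := cvg_comp _ _ gen_inverse_cvgy (F_rv y0).
have y_neq0 : y `^ (- a) != 0 by rewrite gt_eqF// powR_gt0.
apply: cvg_trans (cvgM cx (cvgV y_neq0 cy)); apply: near_eq_cvg; near=> n.
have b0 : 0 < b n by near: n; exact: b_gt0.
rewrite /= invf_div mulrA mulfVK// gt_eqF// F_gt0//.
Unshelve. all: by end_near. Qed.

(** On the two sides of [b n] the product [n F] is above and below 1, and by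
    regular variation a factor [1 + d] or [1 - d] in the argument changes [F]
    by a factor close to 1. *)
Let norm1 : n%:R * F (b n) @[n --> \oo] --> (1 : R).
Proof.
have a0 : 0 < a by case/andP: a01.
have a1 : a <= 1 by case/andP: a01 => _ /ltW.
apply/cvgrPdist_le => e e0.
pose d := Num.min (e / 2) 2^-1.
have d0 : 0 < d by rewrite lt_min divr_gt0//= invr_gt0.
have de : d < e.
  by rewrite gt_min ltr_pdivrMr// ltr_pMr// ltr1n.
have d1 : d < 1 by rewrite gt_min invf_lt1// ltr1n orbT.
have d10 : 0 < 1 - d by rewrite subr_gt0.
have dp : 0 < 1 + d by rewrite addr_gt0.
have up : \forall n \near \oo, F (1 * b n) / F ((1 + d) * b n) < 1 + e.
  apply: (cvgr_lt _ (ratio ltr01 dp)).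
  rewrite powR1 powRN div1r invrK.
  by apply: (@le_lt_trans _ _ (1 + d)); rewrite ?ltrD2l// ler1_powR// lerDl ltW.
have lo : \forall n \near \oo, 1 - e < F (1 * b n) / F ((1 - d) * b n).
  apply: (cvgr_gt _ (ratio ltr01 d10)).
  rewrite powR1 powRN div1r invrK.
  apply: (@lt_le_trans _ _ (1 - d)); first by rewrite ltrD2l ltrN2.
  by rewrite ger1_powR// d10/= gerBl ltW.
near=> n.
have b0 : 0 < b n by near: n; exact: b_gt0.
rewrite ler_distlC; apply/andP; split.
  apply: (@le_trans _ _ (F (1 * b n) / F ((1 - d) * b n))); first by apply/ltW; near: n.
  rewrite mul1r ler_pdivrMr ?F_gt0 ?mulr_gt0// mulrAC ler_peMl ?(ltW (F_gt0 b0))//.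
  by apply: below; [rewrite mulr_gt0|rewrite gtr_pMl// gtrBl].
apply: (@le_trans _ _ (F (1 * b n) / F ((1 + d) * b n))); last by apply/ltW; near: n.
rewrite mul1r ler_pdivlMr ?F_gt0 ?mulr_gt0// mulrAC ler_piMl ?(ltW (F_gt0 b0))//.
by apply: above; rewrite ltr_pMl// ltrDl.
Unshelve. all: by end_near. Qed.

Lemma gen_inverse_norming x : 0 < x ->
  n%:R * F (x * b n) @[n --> \oo] --> x `^ (- a).
Proof.
move=> x0; rewrite -[X in _ --> X]mul1r.
have cx := cvg_comp _ _ gen_inverse_cvgy (F_rv x0).
apply: cvg_trans (cvgM norm1 cx); apply: near_eq_cvg; near=> n.
have b0 : 0 < b n by near: n; exact: b_gt0.
by rewrite /= -mulrA [X in _ * X]mulrC divfK// gt_eqF// F_gt0.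
Unshelve. all: by end_near. Qed.

End norming_sequence.

(** * Power tails and an integrable envelope *)

Lemma powRN_cvg0 {R : realType} (b : R) :
  0 < b -> x `^ (- b) @[x --> +oo] --> (0 : R).
Proof.
move=> b0; apply/cvgrPdist_le => e e0; near=> x.
have x0 : 0 < e `^ (- b^-1) by rewrite powR_gt0.
rewrite sub0r normrN ger0_norm ?powR_ge0// -[leRHS](powRNK b0 e0).
by apply: ler_powRN; rewrite ?(ltW b0)//; near: x; exact: nbhs_pinfty_ge.
Unshelve. all: by end_near. Qed.

Lemma integral_powR_tail {R : realType} (b x : R) : 0 < b -> 0 < x ->
  (\int[lebesgue_measure]_(y in `]x, +oo[) (b * y `^ (- 1 - b))%:E =
   (x `^ (- b))%:E)%E.
Proof.
move=> b0 x0.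
have cont (y : R) : 0 < y -> {for y, continuous (fun y : R => b * y `^ (- 1 - b))}.
  by move=> y0; apply: cvgM; [exact: cvg_cst|exact: continuous_powR].
have mf : measurable_fun [set: R] (fun y : R => b * y `^ (- 1 - b)).
  by apply: measurable_funM => //; exact: measurable_powR.
rewrite integral_itv_obnd_cbnd; last exact/measurable_EFinP/measurable_funTS.
have drv (y : R) : 0 < y -> is_derive y 1 (fun y : R => - (y `^ (- b)))
    (b * y `^ (- 1 - b)).
  move=> y0; have dy := is_derive1_powR (- b) y0.
  apply: is_derive_eq (is_deriveN dy) _.
  by rewrite mulNr opprK addrC.
rewrite (@ge0_continuous_FTC2y _ _ (fun y => - (y `^ (- b))) _ 0).
- by rewrite -EFinB sub0r opprK.
- by move=> y _; rewrite mulr_ge0 ?powR_ge0// ltW.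
- apply: continuous_in_subspaceT => y /[!inE]/=; rewrite in_itv/= andbT => xy.
  exact/cont/(lt_le_trans x0 xy).
- by rewrite -oppr0; apply: cvgN; exact: powRN_cvg0.
- by move=> y xy; have [] := drv _ (lt_trans x0 xy).
- apply: cvgN; apply: cvg_at_right_filter; exact: continuous_powR.
- move=> y; rewrite in_itv/= andbT => xy.
  by have [_ E] := drv _ (lt_trans x0 xy); rewrite derive1E.
Qed.

(** For [u > 0] this is the minimum of [1] and [(C / u) `^ (1 + b)]. *)
Definition envelope {R : realType} (C b u : R) : R :=
  \1_(`]0, C]%classic : set R) u +
  C `^ (1 + b) * (u `^ (- 1 - b) * \1_(`]C, +oo[%classic : set R) u).

Lemma envelope_ge0 {R : realType} (C b u : R) : 0 <= envelope C b u.
Proof. by rewrite addr_ge0 ?mulr_ge0 ?powR_ge0//= indicE ler0n. Qed.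

Lemma envelope_integrable {R : realType} (C b : R) : 0 < C -> 0 < b ->
  (@lebesgue_measure R).-integrable [set: R] (EFin \o envelope C b).
Proof.
move=> C0 b0.
have m1 : measurable_fun [set: R] (\1_(`]0, C]%classic : set R) : R -> R).
  exact: measurable_indic.
have m2 : measurable_fun [set: R]
    (fun u : R => u `^ (- 1 - b) * \1_(`]C, +oo[%classic : set R) u).
  by apply: measurable_funM; [exact: measurable_powR|exact: measurable_indic].
rewrite (_ : EFin \o _ = fun u => (\1_(`]0, C]%classic : set R) u)%:E +
  (C `^ (1 + b) / b)%:E *
    (b * (u `^ (- 1 - b) * \1_(`]C, +oo[%classic : set R) u))%:E)%E; last first.
  apply/funext => u /=; rewrite -EFinM -EFinD; congr EFin; rewrite /envelope.
  by congr (_ + _); rewrite [RHS]mulrA divfK// gt_eqF.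
apply: integrableD => //.
  apply/integrableP; split; first exact/measurable_EFinP.
  under eq_integral do rewrite gee0_abs ?lee_fin//.
  have -> : (\int[lebesgue_measure]_x (\1_(`]0%R, C]%classic : set R) x)%:E =
      lebesgue_measure (`]0%R, C]%classic : set R))%E by rewrite integral_indic// setIT.
  rewrite lebesgue_measure_itv/= lte_fin C0.
  by rewrite oppr0 adde0 ltry.
apply: integrableZl => //.
apply/integrableP; split.
  by apply/measurable_EFinP; apply: measurable_funM.
rewrite (_ : (\int[_]_x _)%E = (C `^ (- b))%:E) ?ltry//.
rewrite -integral_powR_tail// [RHS]integral_mkcond; apply: eq_integral => u _.
rewrite patchE; case: ifPn => uC.
  rewrite indicE uC mulr1 gee0_abs// lee_fin mulr_ge0 ?powR_ge0//; exact: ltW.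
by rewrite indicE (negbTE uC) !mulr0 abse0.
Qed.

(** Inverting a tail that blows up at 0 like a power of exponent less than 1
    gives a quantile that decays at infinity like a power of exponent more
    than 1, hence an integrable one. *)
Lemma min1_quantile_le {R : realType} (T : R -> R) (C b : R) :
  tail_function T -> 1 <= C -> 0 < b ->
  (forall x, 0 < x <= 1 -> T x <= C * x `^ (- (1 + b)^-1)) ->
  forall u, Num.min 1 (quantile T u) <= envelope C b u.
Proof.
move=> tT C1 b0 TC u; have C0 : 0 < C := lt_le_trans ltr01 C1.
have [u0|u0] := leP u 0.
  by rewrite quantile_le0// (le_trans _ (envelope_ge0 _ _ _))// ge_min lexx orbT.
rewrite /envelope !indicE !mem_setE !in_itv/= u0 andbT/=.
have [uC|Cu] := leP u C; first by rewrite !mulr0 addr0 ge_min lexx.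
rewrite add0r mulr1 ge_min; apply/orP; right.
have b1 : 0 < 1 + b by rewrite addr_gt0.
have x0 : 0 < C / u by rewrite divr_gt0.
have xE : C `^ (1 + b) * u `^ (- 1 - b) = (C / u) `^ (1 + b).
  rewrite powRM ?invr_ge0 ?(ltW C0) ?(ltW u0)//.
  by rewrite -opprD -[u^-1]powR_inv1 ?(ltW u0)// -powRrM mulN1r.
rewrite xE; apply: quantile_le => //; first exact: powR_gt0.
have uE : u = C * ((C / u) `^ (1 + b)) `^ (- (1 + b)^-1).
  rewrite -powRrM mulrN divff ?gt_eqF// powR_inv1 ?(ltW x0)// invf_div.
  by rewrite mulrCA divff ?mulr1// gt_eqF.
rewrite [leRHS]uE; apply: TC; rewrite powR_gt0//=.
rewrite -[leRHS](_ : 1 `^ (1 + b) = 1); last by rewrite powR1.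
apply: ge0_ler_powR; rewrite ?nnegrE ?(ltW b1) ?(ltW x0)//.
by rewrite ler_pdivrMr// mul1r ltW.
Qed.

(** * Levy measures *)

Section levy_measure.
Context {R : realType}.
Variable a : R.
Hypothesis a0 : 0 < a.

Lemma measurable_patch_pos (q : R -> R) :
  measurable_fun (`[0, +oo[%classic : set R) q ->
  measurable_fun [set: R] (q \_ `]0, +oo[).
Proof.
move=> mq; apply: (iffLR (measurable_restrictT _ (measurable_itv _))).
apply: measurable_funS mq => //.
by apply: subset_itvr; rewrite bnd_simp.
Qed.

Lemma patch_pos_ge0 (q : R -> R) x :
  (forall y, 0 <= y -> 0 <= q y) -> 0 <= (q \_ `]0, +oo[) x.
Proof.
move=> q0; rewrite patchE mem_setE in_itv/= andbT.
by case: ltP => // x0; apply: q0; exact: ltW.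
Qed.

Lemma levy_densityE eta (q : R -> R) x :
  levy_density a eta q x = eta * (q \_ `]0, +oo[) x * x `^ (- 1 - a).
Proof.
rewrite /levy_density indicE patchE mem_setE in_itv/= andbT.
by case: ltP => _; rewrite ?mulr1// !mulr0 mul0r.
Qed.

Lemma measurable_levy_density eta (q : R -> R) :
  measurable_fun (`[0, +oo[%classic : set R) q ->
  measurable_fun [set: R] (levy_density a eta q).
Proof.
move=> mq; rewrite (_ : levy_density a eta q = fun x =>
  eta * (q \_ `]0, +oo[) x * x `^ (- 1 - a)); last first.
  by apply/funext => x; exact: levy_densityE.
apply: measurable_funM; last exact: measurable_powR.
by apply: measurable_funM => //; exact: measurable_patch_pos.
Qed.

Lemma levy_density_ge0 eta (q : R -> R) x : 0 <= eta ->
  (forall y, 0 <= y -> 0 <= q y) -> 0 <= levy_density a eta q x.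
Proof.
by move=> e0 q0; rewrite levy_densityE !mulr_ge0 ?powR_ge0 ?patch_pos_ge0.
Qed.

Lemma levy_measure_exists eta (q : R -> R) : 0 <= eta ->
  measurable_fun (`[0, +oo[%classic : set R) q ->
  (forall y, 0 <= y -> 0 <= q y) ->
  exists M : {measure set (measurableTypeR R) -> \bar R},
    has_density M (levy_density a eta q).
Proof.
move=> e0 mq q0.
have mld : measurable_fun (T := measurableTypeR R) (U := R) setT
    (levy_density a eta q) by exact: measurable_levy_density.
have [M ME] := density_measure lebesgue_measure mld
  (fun x => levy_density_ge0 x e0 q0).
by exists M => A _; exact: ME.
Qed.

Lemma stable_levy_tail (m : {measure set (measurableTypeR R) -> \bar R}) :
  has_density m (levy_density a a (cst 1)) ->
  forall x, 0 < x -> m `]x, +oo[%classic = (x `^ (- a))%:E.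
Proof.
move=> mE x x0; rewrite mE; last exact: measurable_itv.
rewrite -integral_powR_tail//; apply: eq_integral => y /set_mem/=.
rewrite in_itv/= andbT => xy; rewrite levy_densityE patchE mem_setE in_itv/=.
by rewrite (lt_trans x0 xy)/= mulr1.
Qed.

(** Tempering is a density with respect to the stable Levy measure [m], so
    that integrals against all limiting Levy measures become integrals against
    [m]. *)
Lemma integral_levy_measure (m M : {measure set (measurableTypeR R) -> \bar R})
    (q : R -> R) (h : R -> R) :
  has_density m (levy_density a a (cst 1)) ->
  has_density M (levy_density a a q) ->
  measurable_fun (`[0, +oo[%classic : set R) q ->
  (forall y, 0 <= y -> 0 <= q y) ->
  measurable_fun [set: R] h -> (forall x, 0 < x -> 0 <= h x) ->
  (\int[M]_(x in `]0%R, +oo[) (h x)%:E =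
   \int[m]_x ((h x * (q \_ `]0, +oo[) x))%:E)%E.
Proof.
move=> mE ME mq q0 mh h0.
pose hp := h \_ (`]0, +oo[%classic : set R).
have mhp : measurable_fun [set: R] hp.
  apply: measurable_patch_pos; exact: measurable_funTS.
have hp0 x : 0 <= hp x.
  rewrite /hp patchE mem_setE in_itv/= andbT.
  by case: ltP => // x0; exact: h0.
have mq' := measurable_patch_pos mq.
have q'0 x := patch_pos_ge0 x q0.
have one0 (y : R) : 0 <= y -> 0 <= (cst 1 : R -> R) y by [].
have hqE x : h x * (q \_ `]0, +oo[) x = hp x * (q \_ `]0, +oo[) x.
  by rewrite /hp !patchE; case: ifP => // _; rewrite !mulr0.
transitivity (\int[M]_x (hp x)%:E)%E.
  rewrite integral_mkcond; apply: eq_integral => x _.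
  by rewrite /hp !patchE; case: ifP.
have mld p : measurable_fun (`[0, +oo[%classic : set R) p ->
    measurable_fun (T := measurableTypeR R) (U := R) setT (levy_density a a p).
  by move=> mp; exact: measurable_levy_density.
have ld0 p x : (forall y, 0 <= y -> 0 <= p y) -> 0 <= levy_density a a p x.
  by move=> p0; apply: levy_density_ge0 => //; exact: ltW.
have mhp' : measurable_fun (T := measurableTypeR R) setT (fun x => (hp x)%:E).
  exact/measurable_EFinP.
have mhq : measurable_fun (T := measurableTypeR R) setT
    (fun x => (h x * (q \_ `]0, +oo[) x)%:E).
  apply/measurable_EFinP; under eq_fun do rewrite hqE.
  exact: measurable_funM.
have hq0 x : (0 <= (h x * (q \_ `]0, +oo[) x)%:E)%E.
  by rewrite lee_fin hqE mulr_ge0.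
rewrite (ge0_integral_density (mld q mq) (fun x => ld0 q x q0) ME mhp'); last first.
  by move=> x; rewrite lee_fin.
rewrite [RHS](ge0_integral_density (mld _ (measurable_cst _))
  (fun x => ld0 _ x one0) mE mhq hq0).
apply: eq_integral => x _; rewrite hqE -!EFinM !levy_densityE /hp !patchE.
by case: ifP => _; congr EFin; rewrite ?mul0r//=; ring.
Qed.

End levy_measure.

(** * Convergence of Laplace exponents *)

Lemma power_tail {R : realType} (a : R) :
  0 < a -> tail_function (fun x : R => x `^ (- a)).
Proof.
move=> a0; split.
- by move=> x _; exact: powR_ge0.
- by move=> x y x0 xy; apply: ler_powRN => //; exact: ltW.
move=> u u0; exists (u `^ (- a^-1)); first exact: powR_gt0.
by rewrite powRNK.
Qed.

Lemma quantile_power_tail {R : realType} (a u : R) : 0 < a -> 0 < u ->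
  quantile (fun x : R => x `^ (- a)) u = u `^ (- a^-1).
Proof.
move=> a0 u0; apply/eqP; rewrite eq_le; apply/andP; split.
  by apply: quantile_le => //; [exact: powR_gt0|rewrite powRNK].
rewrite /quantile u0; apply: lb_le_inf.
  by exists (u `^ (- a^-1)) => /=; rewrite powRNK// powR_gt0.
have ia0 : 0 < a^-1 by rewrite invr_gt0.
move=> y [y0 yu]; rewrite -[leRHS](powRNK ia0 y0) invrK.
by apply: ler_powRN => //; [exact: ltW|exact: powR_gt0].
Qed.

Lemma power_tail_continuity {R : realType} (a u : R) : 0 < a -> 0 < u ->
  quantile_continuity_point (fun x : R => x `^ (- a)) u.
Proof.
move=> a0 u0; have c := @continuous_powR _ (- a^-1) _ u0.
split=> // e e0; move/cvgrPdist_lt : (c) => /(_ _ e0) ce.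
- have : \forall v \near u^'-, [/\ 0 < v, v < u & `|u `^ (- a^-1) - v `^ (- a^-1)| < e].
    near=> v; split; [near: v; exact: nbhs_left_gt|near: v; exact: nbhs_left_lt|].
    by near: v; apply: cvg_at_left_filter ce; exact: cvg_id.
  move=> /filter_ex[v [v0 vu]]; rewrite ltr_distlC => /andP[_ ve].
  by exists v; [rewrite v0|rewrite !quantile_power_tail].
- have : \forall v \near u^'+, u < v /\ `|u `^ (- a^-1) - v `^ (- a^-1)| < e.
    near=> v; split; [near: v; exact: nbhs_right_gt|].
    by near: v; apply: cvg_at_right_filter ce; exact: cvg_id.
  move=> /filter_ex[v [uv]]; rewrite ltr_distlC => /andP[ve _].
  by exists v => //; rewrite !quantile_power_tail//; exact: lt_trans uv.
Unshelve. all: by end_near. Qed.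

Lemma onem_expR_le {R : realType} (z x : R) : 0 <= z -> 0 <= x ->
  0 <= 1 - expR (- (z * x)) <= Num.max 1 z * Num.min 1 x.
Proof.
move=> z0 x0; have zx0 : 0 <= z * x by rewrite mulr_ge0.
rewrite subr_ge0 -{1}expR0 ler_expR oppr_le0 zx0/=.
have zM : z <= Num.max 1 z by rewrite le_max lexx orbT.
have M1 : 1 <= Num.max 1 z by rewrite le_max lexx.
have [x1|x1] := leP 1 x.
  by rewrite mulr1 (le_trans _ M1)// lerBlDr lerDl expR_ge0.
apply: (@le_trans _ _ (z * x)); last by rewrite ler_wpM2r.
by have := expR_ge1Dx (- (z * x)); lra.
Qed.

(** The factor [q] is cut to ]0, +oo[ because the coupling sees nothing else.
    *)
Definition levy_integrand {R : realType} (z : R) (q : R -> R) (x : R) : R :=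
  (1 - expR (- (z * x))) * (q \_ `]0, +oo[) x.

Lemma measurable_levy_integrand {R : realType} (z : R) (q : R -> R) :
  measurable_fun (`[0, +oo[%classic : set R) q ->
  measurable_fun [set: R] (levy_integrand z q).
Proof.
move=> mq; apply: measurable_funM; last exact: measurable_patch_pos.
apply: measurable_funB => //; apply: measurableT_comp; first exact: measurable_expR.
by apply: measurable_funN; apply: measurable_funM.
Qed.

Lemma levy_integrand_npos {R : realType} (z : R) (q : R -> R) x :
  x <= 0 -> levy_integrand z q x = 0.
Proof.
by move=> x0; rewrite /levy_integrand patchE mem_setE in_itv/= ltNge x0 mulr0.
Qed.

Lemma levy_integrand_pos {R : realType} (z : R) (q : R -> R) x :
  0 < x -> levy_integrand z q x = (1 - expR (- (z * x))) * q x.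
Proof. by move=> x0; rewrite /levy_integrand patchE mem_setE in_itv/= x0. Qed.

Lemma levy_integrand_ge0 {R : realType} (z : R) (q : R -> R) x :
  0 <= z -> (forall y, 0 <= y -> 0 <= q y) -> 0 <= levy_integrand z q x.
Proof.
move=> z0 q0; have [x0|x0] := leP x 0; first by rewrite levy_integrand_npos.
rewrite levy_integrand_pos// mulr_ge0 ?q0 ?(ltW x0)//.
by case/andP: (onem_expR_le z0 (ltW x0)).
Qed.

Lemma levy_integrand_le {R : realType} (K z : R) (q : R -> R) x :
  (forall y, 0 <= y -> 0 <= q y <= K) -> 0 <= z -> 0 <= x ->
  levy_integrand z q x <= K * Num.max 1 z * Num.min 1 x.
Proof.
move=> q0K z0 x0; have K0 : 0 <= K.
  by have /andP[q0 qK] := q0K 0 (lexx 0); exact: le_trans qK.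
have M0 : 0 <= Num.max 1 z by rewrite le_max ler01.
have m0 : 0 <= Num.min 1 x by rewrite le_min ler01.
move: x0 m0; rewrite le_eqVlt => /predU1P[<-|x0] m0.
  by rewrite levy_integrand_npos// !mulr_ge0.
have /andP[q0 qK] := q0K x (ltW x0).
have /andP[e0 e1] := onem_expR_le z0 (ltW x0).
rewrite levy_integrand_pos// -mulrA [leRHS]mulrC.
by apply: ler_pM.
Qed.

Section exponent_convergence.
Context {R : realType}.
Variables (a K C b : R) (mu : probability (measurableTypeR R) R) (F : R -> R).
Variables (beta : nat -> R) (m : {measure set (measurableTypeR R) -> \bar R}).
Variables (qn : nat -> R -> R) (qs : R -> R) (N : set (measurableTypeR R)).
Hypothesis a0 : 0 < a.
Hypothesis muF : forall x, 0 < x -> mu `]x, +oo[%classic = (F x)%:E.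
Hypothesis beta0 : forall n, 0 < beta n.
Hypothesis F_cvg : forall x, 0 < x ->
  n%:R * F (x * beta n) @[n --> \oo] --> x `^ (- a).
Hypothesis C1 : 1 <= C.
Hypothesis b0 : 0 < b.
Hypothesis F_bound : \forall n \near \oo, forall x, 0 < x <= 1 ->
  n%:R * F (x * beta n) <= C * x `^ (- (1 + b)^-1).
Hypothesis m_tail : forall x, 0 < x -> m `]x, +oo[%classic = (x `^ (- a))%:E.
Hypothesis mqn : forall n, measurable_fun (`[0, +oo[%classic : set R) (qn n).
Hypothesis qn0 : forall n x, 0 <= x -> 0 <= qn n x.
Hypothesis qnK : forall n x, 0 <= x -> qn n x <= K.
Hypothesis mqs : measurable_fun (`[0, +oo[%classic : set R) qs.
Hypothesis qs0 : forall x, 0 <= x -> 0 <= qs x.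
Hypothesis mN : measurable N.
Hypothesis N0 : m N = 0%E.
Hypothesis qn_qs : forall (x : R) (u : nat -> R), 0 < x -> ~ N x ->
  u n @[n --> \oo] --> x -> qn n (u n) @[n --> \oo] --> qs x.

Local Notation g := levy_integrand.

Let g_le z n x : 0 <= z -> 0 <= x ->
  g z (qn n) x <= K * Num.max 1 z * Num.min 1 x.
Proof. by move=> z0 x0; apply: levy_integrand_le => // y y0; rewrite qn0 ?qnK. Qed.

Let T n x := n%:R * F (x * beta n).
Let H (x : R) := x `^ (- a).
Let tH : tail_function H := power_tail a0.

Let mscaled n : measurable_fun (T := measurableTypeR R) (U := measurableTypeR R)
  [set: R] (fun x : R => x / beta n).
Proof. exact: measurable_funM. Qed.

Let phi n : {mfun (measurableTypeR R) >-> (measurableTypeR R)} :=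
  HB.pack_for {mfun (measurableTypeR R) >-> (measurableTypeR R)}
    (fun x : R => x / beta n) (isMeasurableFun.Build _ _ _ _ _ (mscaled n)).

Let mu_n n : {measure set (measurableTypeR R) -> \bar R} :=
  mscale n%:R%:nng (distribution mu (phi n)).

Let mu_n_tail n x : 0 < x -> mu_n n `]x, +oo[%classic = (T n x)%:E.
Proof.
move=> x0; rewrite /mu_n /= /mscale /distribution /pushforward /T.
rewrite EFinM -muF ?mulr_gt0//; congr (_ * mu _)%E.
by apply/seteqP; split => y /=; rewrite !in_itv/= !andbT ltr_pdivlMr.
Qed.

Let tT n : tail_function (T n) := tail_functionP (@mu_n_tail n).

Let integral_mu_n z n : 0 <= z ->
  (n%:R%:E * \int[mu]_x (g z (qn n) (x / beta n))%:E =
   \int[lebesgue_measure]_u (g z (qn n) (quantile (T n) u))%:E)%E.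
Proof.
move=> z0; have mgq : measurable_fun [set: R] (fun x => (g z (qn n) x)%:E).
  by apply/measurable_EFinP; exact: measurable_levy_integrand.
have gq0 x : (0 <= (g z (qn n) x)%:E)%E by rewrite lee_fin levy_integrand_ge0//; exact: qn0.
rewrite -(integral_quantile (tT n) (@mu_n_tail n) mgq gq0); last first.
  by move=> x x0; rewrite levy_integrand_npos.
rewrite /mu_n ge0_integral_mscale//=.
by rewrite ge0_integral_distribution.
Qed.

Let integral_m z : 0 <= z ->
  (\int[m]_x (g z qs x)%:E =
   \int[lebesgue_measure]_u (g z qs (quantile H u))%:E)%E.
Proof.
move=> z0; have mgq : measurable_fun [set: R] (fun x => (g z qs x)%:E).
  by apply/measurable_EFinP; exact: measurable_levy_integrand.
have gq0 x : (0 <= (g z qs x)%:E)%E by rewrite lee_fin levy_integrand_ge0.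
apply: (integral_quantile tH m_tail mgq gq0).
by move=> x x0; rewrite levy_integrand_npos.
Qed.

Let quantile_T_cvg u : 0 < u ->
  quantile (T n) u @[n --> \oo] --> quantile H u.
Proof.
move=> u0; apply: quantile_cvg => //; last exact: power_tail_continuity.
- move=> s t e s0 st e0; have t0 := lt_trans s0 st.
  have := F_cvg t0 => /cvgrPdist_le /(_ _ e0); apply: filterS => n.
  rewrite ler_distlC => /andP[_ Tt]; apply: (le_trans Tt); rewrite lerD2r.
  by apply: (tail_le tH) => //; exact: ltW.
- move=> s t e s0 st e0; have t0 := lt_trans s0 st.
  have := F_cvg s0 => /cvgrPdist_le /(_ _ e0); apply: filterS => n.
  rewrite ler_distlC lerBlDr => /andP[Ts _]; apply: le_trans Ts.
  by apply: (tail_le tH) => //; exact: ltW.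
Qed.

Let null_quantile : lebesgue_measure.-negligible
  (quantile H @^-1` (N `&` `]0, +oo[%classic)).
Proof.
have mNp : measurable (N `&` `]0, +oo[%classic : set (measurableTypeR R)).
  by apply: measurableI => //; exact: measurable_itv.
have mQ : measurable_fun (T := measurableTypeR R) (U := measurableTypeR R)
    [set: R] (quantile H) by exact: measurable_quantile.
exists (quantile H @^-1` (N `&` `]0, +oo[%classic)); split => //.
  by rewrite -[X in measurable X]setTI; exact: mQ.
rewrite -(quantile_coupling tH m_tail)//.
exact: (@subset_measure0 _ _ _ m _ N).
Qed.

Let integrand_cvg z : 0 <= z -> {ae lebesgue_measure, forall u : R,
  [set: R] u -> (g z (qn n) (quantile (T n) u))%:E @[n --> \oo] -->
    (g z qs (quantile H u))%:E}.
Proof.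
move=> z0; apply: negligibleS null_quantile => u /= nc.
have u0 : 0 < u.
  rewrite ltNge; apply/negP => u0; apply: nc => _.
  rewrite quantile_le0// levy_integrand_npos//; apply: cvg_near_cst; apply: nearW => n.
  by rewrite quantile_le0// levy_integrand_npos.
have x0 : 0 < quantile H u by rewrite quantile_power_tail// powR_gt0.
split; last by rewrite /= in_itv/= x0.
apply: contrapT => nN; apply: nc => _.
have Qc := quantile_T_cvg u0.
apply: cvg_EFin; first exact: nearW.
rewrite levy_integrand_pos//.
have Qpos : \forall n \near \oo, 0 < quantile (T n) u by apply: (cvgr_gt _ Qc).
have lim : (1 - expR (- (z * quantile (T n) u))) * qn n (quantile (T n) u)
    @[n --> \oo] --> (1 - expR (- (z * quantile H u))) * qs (quantile H u).
  apply: cvgM; last exact: qn_qs.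
  apply: cvgB; first exact: cvg_cst.
  apply: continuous_cvg; first exact: continuous_expR.
  by apply: cvgN; apply: cvgM => //; exact: cvg_cst.
apply: cvg_trans lim; apply: near_eq_cvg.
by apply: filterS Qpos => n Qn; rewrite /= levy_integrand_pos.
Qed.

(** Both integrals are Lebesgue integrals of such integrands along quantiles:
    those of [n mu] scaled by [beta n], and those of [m]. The quantiles
    converge at every level, [qn n] converges along them except at levels that
    the coupling sends into [N], and [envelope] dominates. *)
Lemma levy_exponent_cvg z : 0 <= z ->
  (\int[m]_x (g z qs x)%:E)%E \is a fin_num /\
  (n%:R%:E * \int[mu]_x (g z (qn n) (x / beta n))%:E)%E @[n --> \oo] -->
    (\int[m]_x (g z qs x)%:E)%E.
Proof.
move=> z0; rewrite integral_m//.
rewrite (_ : (fun n => _) = fun n =>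
  (\int[lebesgue_measure]_u (g z (qn n) (quantile (T n) u))%:E)%E); last first.
  by apply/funext => n; exact: integral_mu_n.
have [n0 _ n0P] := F_bound.
pose A := K * Num.max 1 z.
have K0 : 0 <= K := le_trans (qn0 0 (lexx 0)) (qnK 0 (lexx 0)).
have A0 : 0 <= A by rewrite mulr_ge0// le_max ler01.
(* The tails are only bounded from [n0] on, so the sequence is shifted. *)
pose f n u := (g z (qn (n + n0)) (quantile (T (n + n0)) u))%:E.
have mf n : measurable_fun (T := measurableTypeR R) [set: R] (f n).
  apply/measurable_EFinP; apply: measurableT_comp; first exact: measurable_levy_integrand.
  exact: measurable_quantile.
have mfs : measurable_fun (T := measurableTypeR R) [set: R]
    (fun u => (g z qs (quantile H u))%:E).
  apply/measurable_EFinP; apply: measurableT_comp; first exact: measurable_levy_integrand.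
  exact: measurable_quantile.
have ie : lebesgue_measure.-integrable [set: R] (fun u => (A * envelope C b u)%:E).
  rewrite (_ : (fun u => _) = fun u => (A%:E * (EFin \o envelope C b) u)%E)//.
  by apply: integrableZl => //; apply: envelope_integrable => //; exact: lt_le_trans C1.
have [] := @dominated_convergence _ _ _ lebesgue_measure setT measurableT
  f _ (fun u => (A * envelope C b u)%:E) mf mfs _ ie.
- have [N' [mN' N'0 N'P]] := integrand_cvg z0; exists N'; split => // u /= nu.
  apply: N'P => /= cu; apply: nu => _.
  exact: cvg_comp (cvg_addnr n0) (cu I).
- apply: aeW => u n _; rewrite /f gee0_abs ?lee_fin ?levy_integrand_ge0//; last exact: qn0.
  apply: (le_trans (g_le _ z0 (quantile_ge0 _ _))).
  rewrite ler_wpM2l//; apply: min1_quantile_le => // x x01.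
  by apply: n0P => //=; rewrite leq_addl.
move=> ifs _ fc; split.
  exact: integrable_fin_num ifs.
by rewrite -(cvg_shiftn n0).
Qed.

End exponent_convergence.

(** * The limit law *)

(** The tail [x `^ (- a)] satisfies the hypothesis of [min1_quantile_le] with
    [1 + b = a^-1]. *)
Lemma power_min1_integrable {R : realType} (a : R)
    (m : {measure set (measurableTypeR R) -> \bar R}) : 0 < a < 1 ->
  (forall x, 0 < x -> m `]x, +oo[%classic = (x `^ (- a))%:E) ->
  m.-integrable setT (fun x => (((Num.min 1 : R -> R) \_ `]0, +oo[) x)%:E).
Proof.
move=> /andP[a0 a1] mT.
have m1 : measurable_fun [set: R] ((Num.min 1 : R -> R) \_ `]0, +oo[).
  apply: measurable_patch_pos; apply: measurable_minr => //.
have p0 x : (0 <= (((Num.min 1 : R -> R) \_ `]0, +oo[) x)%:E)%E.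
  by rewrite lee_fin; apply: patch_pos_ge0 => y y0; rewrite le_min ler01.
apply/integrableP; split; first exact/measurable_EFinP.
under eq_integral do rewrite gee0_abs//.
rewrite (integral_quantile (power_tail a0) mT)//; last 2 first.
- exact/measurable_EFinP.
- by move=> x x0; rewrite patchE mem_setE in_itv/= ltNge x0.
pose b := a^-1 - 1.
have b0 : 0 < b by rewrite subr_gt0 invf_gt1.
have := @envelope_integrable R 1 b ltr01 b0 => /integrableP[me]; apply: le_lt_trans.
apply: ge0_le_integral => //.
- apply/measurable_EFinP; apply: measurableT_comp => //.
  by apply: measurable_quantile; exact: power_tail.
- exact: measurableT_comp.
move=> u _; rewrite gee0_abs ?lee_fin ?envelope_ge0//=.
apply: le_trans (@min1_quantile_le _ _ 1 b (power_tail a0) (lexx 1) b0 _ u).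
  rewrite patchE mem_setE in_itv/= andbT; case: ltP => // _.
  by rewrite le_min ler01 quantile_ge0.
by move=> x /andP[x0 x1]; rewrite mul1r /b addrC subrK invrK.
Qed.

Section limit_law.
Context {R : realType}.
Variables (a K : R) (m : {measure set (measurableTypeR R) -> \bar R}).
Variable (q : R -> R).
Hypothesis a01 : 0 < a < 1.
Hypothesis mE : has_density m (levy_density a a (cst 1)).
Hypothesis mq : measurable_fun (`[0, +oo[%classic : set R) q.
Hypothesis q0K : forall y, 0 <= y -> 0 <= q y <= K.

Let a0 : 0 < a. Proof. by case/andP: a01. Qed.
Let mT := stable_levy_tail a0 mE.
Let q0 y : 0 <= y -> 0 <= q y. Proof. by move=> /q0K /andP[]. Qed.
Definition levy_exponent z := fine (\int[m]_x (levy_integrand z q x)%:E)%E.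

Lemma levy_integrand_dominated z x : 0 <= z ->
  levy_integrand z q x <=
  K * Num.max 1 z * ((Num.min 1 : R -> R) \_ `]0, +oo[) x.
Proof.
move=> z0; rewrite patchE mem_setE in_itv/= andbT; case: ltP => x0.
  by apply: levy_integrand_le => //; exact: ltW.
by rewrite levy_integrand_npos// mulr0.
Qed.

Let dominated_integrable z :
  m.-integrable setT
    (fun x => (K * Num.max 1 z * ((Num.min 1 : R -> R) \_ `]0, +oo[) x)%:E).
Proof.
rewrite (_ : (fun x => _) = fun x => ((K * Num.max 1 z)%:E *
  (((Num.min 1 : R -> R) \_ `]0, +oo[) x)%:E)%E)//.
by apply: integrableZl => //; exact: power_min1_integrable a01 mT.
Qed.

Lemma integral_levy_integrand z : 0 <= z ->
  (\int[m]_x (levy_integrand z q x)%:E = (levy_exponent z)%:E)%E.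
Proof.
move=> z0; rewrite /levy_exponent fineK//.
have int : m.-integrable setT (fun x => (levy_integrand z q x)%:E).
  apply: le_integrable (dominated_integrable z) => //.
    by apply/measurable_EFinP; exact: measurable_levy_integrand.
  move=> x _; rewrite !gee0_abs ?lee_fin ?levy_integrand_ge0//.
    exact: levy_integrand_dominated.
  by apply: le_trans (levy_integrand_dominated x z0); exact: levy_integrand_ge0.
exact: integrable_fin_num int.
Qed.

(** Dominated convergence along [z = 1/(k+1)] shows that the exponent tends to
    0 at 0. *)
Lemma levy_exponent_small e : 0 < e ->
  exists2 z, 0 < z & 1 - expR (- levy_exponent z) < e.
Proof.
move=> e0.
have c : (\int[m]_x (levy_integrand (harmonic k) q x)%:E)%E @[k --> \oo] -->
    (\int[m]_x (cst 0 x)%:E)%E.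
  have [] := @dominated_convergence _ _ _ m setT measurableT
    (fun k x => (levy_integrand (harmonic k) q x)%:E) (fun x => (cst 0 x)%:E)
    _ _ _ _ (dominated_integrable 1) _ => //.
  - by move=> k; apply/measurable_EFinP; exact: measurable_levy_integrand.
  - by apply/measurable_EFinP; exact: measurable_cst.
  - apply: aeW => x _; apply: cvg_EFin; first exact: nearW.
    have [x0|x0] := leP x 0.
      apply: cvg_near_cst; apply: nearW => k /=.
      by rewrite levy_integrand_npos.
    under eq_fun do rewrite /= levy_integrand_pos//.
    rewrite -(mul0r (q x)); apply: cvgM; last exact: cvg_cst.
    rewrite -[X in _ --> X](subrr 1); apply: cvgB; first exact: cvg_cst.
    rewrite -[X in _ --> X]expR0; apply: continuous_cvg; first exact: continuous_expR.
    rewrite -[X in _ --> X]oppr0 -[X in _ --> - X](mul0r x); apply: cvgN.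
    by apply: cvgM; [exact: cvg_harmonic|exact: cvg_cst].
  - apply: aeW => x k _; have h0 : 0 <= harmonic k :> R := harmonic_ge0 k.
    rewrite gee0_abs ?lee_fin ?levy_integrand_ge0//.
    apply: (le_trans (levy_integrand_dominated x h0)).
    rewrite (_ : Num.max 1 (harmonic k) = Num.max 1 1)//.
    rewrite maxxx; apply/max_idPl.
    by rewrite invf_le1 ?ltr0n// ler1n.
rewrite integral0 in c.
have : \forall k \near \oo, (\int[m]_x (levy_integrand (harmonic k) q x)%:E < e%:E)%E.
  have e0' : (0 < e%:E)%E by rewrite lte_fin.
  exact: (c _ (open_ereal_lt' e0')).
move=> /filter_ex[k]; rewrite integral_levy_integrand ?harmonic_ge0// lte_fin => ke.
exists (harmonic k); first exact: harmonic_gt0.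
apply: le_lt_trans ke.
by have := expR_ge1Dx (- levy_exponent (harmonic k)); lra.
Qed.

Lemma PTS_limit_law (nu : probability (measurableTypeR R) R) :
  nu `[0, +oo[%classic = 1%E ->
  (forall z, 0 <= z -> (\int[nu]_(x in `[0%R, +oo[) (expR (- (z * x)))%:E =
     (expR (- levy_exponent z))%:E)%E) ->
  PTS a q a nu.
Proof.
move=> nu0 nuL.
have [M ME] := levy_measure_exists a (ltW a0) mq q0; exists M => //; split=> //.
- rewrite (integral_levy_measure a0 mE ME mq)//.
  + apply: le_lt_trans (integrable_lty measurableT (dominated_integrable 1)).
    have mqp := measurable_patch_pos mq.
    apply: ge0_le_integral => //.
    * move=> x _; rewrite lee_fin patchE mem_setE in_itv/= andbT.
      case: ltP => x0; last by rewrite mulr0.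
      by rewrite mulr_ge0 ?q0 ?(ltW x0)// le_min ler01 (ltW x0).
    * by apply/measurable_EFinP; apply: measurable_funM => //; exact: measurable_minr.
    * exact: measurable_int (dominated_integrable 1).
    move=> x _; rewrite lee_fin maxxx mulr1 !patchE mem_setE in_itv/= andbT.
    case: ltP => x0; last by rewrite !mulr0.
    have /andP[qx0 qxK] := q0K (ltW x0).
    by rewrite mulrC minC ler_wpM2r// le_min ler01 (ltW x0).
  + by apply: measurable_minr.
  + by move=> x x0; rewrite le_min ler01 (ltW x0).
- move=> z z0; rewrite nuL// mul0r oppr0 add0r /Rintegral.
  rewrite (integral_levy_measure a0 mE ME mq)//.
  + apply: measurable_funB => //; apply: measurableT_comp; first exact: measurable_expR.
    by apply: measurable_funN; apply: measurable_funM.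
  + by move=> x x0; case/andP: (onem_expR_le z0 (ltW x0)).
Qed.

End limit_law.

(** * Sums of tempered variables *)

Lemma measurable_rescale {R : realType} (q : R -> R) (l : R) : 0 <= l ->
  measurable_fun (`[0, +oo[%classic : set R) q ->
  measurable_fun (`[0, +oo[%classic : set R) (rescale q l).
Proof.
move=> l0 mq; apply: (measurable_comp _ _ mq) => //.
- move=> _ [x /= x0 <-]; move: x0; rewrite !in_itv/= !andbT => x0.
  by rewrite divr_ge0.
- exact: measurable_funM.
Qed.

Section tempered_sample.
Context {R : realType} {d : measure_display} {T : measurableType d}.
Variables (P : probability T R) (mu : probability (measurableTypeR R) R).
Variables (q : R -> R) (l : R) (n : nat) (X : 'I_n -> {RV P >-> R}).
Hypothesis mq : measurable_fun (`[0, +oo[%classic : set R) q.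
Hypothesis q0 : forall x, 0 <= x -> 0 <= q x.
Hypothesis l0 : 0 <= l.
Hypothesis mass0 : 0 < tempering_mass mu q l.
Hypothesis iidX : iid_with_law X (tempered_law mu q l).

Let c := tempering_const mu q l.
Let c0 : 0 <= c. Proof. by rewrite invr_ge0 ltW. Qed.

Let w x := c * (rescale q l \_ `[0, +oo[) x.

Let mw : measurable_fun [set: R] w.
Proof.
apply: measurable_funM => //.
apply: (iffLR (measurable_restrictT _ (measurable_itv _))).
exact: measurable_rescale.
Qed.

Let w0 x : 0 <= w x.
Proof.
rewrite mulr_ge0// patchE mem_setE in_itv/= andbT.
by case: ifP => // x0; apply: q0; rewrite divr_ge0.
Qed.

Lemma integral_tempered i (h : R -> R) :
  measurable_fun [set: R] h -> (forall x, 0 <= h x) ->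
  (\int[P]_t (h (X i t))%:E = \int[mu]_x (h x * w x)%:E)%E.
Proof.
move=> mh h0.
have mX : measurable_fun (T := T) (U := measurableTypeR R) setT (X i).
  have mXi : measurable_fun setT (X i) by exact: measurable_funP.
  exact: mXi.
pose Xi : {mfun T >-> measurableTypeR R} := HB.pack_for
  {mfun T >-> measurableTypeR R} (X i : T -> R) (isMeasurableFun.Build _ _ _ _ _ mX).
transitivity (\int[distribution P Xi]_x (h x)%:E)%E.
  by rewrite ge0_integral_distribution//; exact/measurable_EFinP.
have mw' : measurable_fun (T := measurableTypeR R) (U := R) setT w by [].
have mh' : measurable_fun (T := measurableTypeR R) setT (fun x => (h x)%:E).
  exact/measurable_EFinP.
rewrite (ge0_integral_density mw' w0 (m := mu) (M := distribution P Xi) _ mh')//.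
move=> A mA; transitivity (tempered_law mu q l A); first exact: iidX.2.
rewrite /tempered_law [LHS]integral_mkcond [RHS]integral_mkcond.
apply: eq_integral => x _; rewrite !patchE in_setI.
case: ifPn => [/andP[-> x0]|]; first by rewrite /w patchE x0.
rewrite negb_and; case: ifPn => //= xA x0.
by rewrite /w patchE (negbTE x0) mulr0.
Qed.

Lemma tempered_ge0 : {ae P, forall t, forall i, 0 <= X i t}.
Proof.
have Xge0 i : {ae P, forall t, 0 <= X i t}.
  exists (X i @^-1` `]-oo, 0[%classic); split.
  - by apply: measurable_funPTI; exact: measurable_itv.
  - transitivity (tempered_law mu q l `]-oo, 0[%classic).
      exact: (iidX.2 i _ (measurable_itv _)).
    rewrite /tempered_law (_ : _ `&` _ = set0) ?integral_set0//.
    rewrite -subset0 => x []; rewrite /= !in_itv/= andbT => x0.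
    by rewrite leNgt x0.
  - by move=> t /negP; rewrite -ltNge /= in_itv.
have Xge0n k : {ae P, forall t, forall kn : (k < n)%N, 0 <= X (Ordinal kn) t}.
  have [kn|kn] := pselect (k < n)%N.
    apply: filterS (Xge0 (Ordinal kn)) => t Xt kn'.
    by rewrite (bool_irrelevance kn' kn).
  by apply: aeW => t kn'.
apply: filterS (ae_foralln Xge0n) => t Xt i.
by have := Xt i (ltn_ord i); congr (_ <= X _ t); exact: val_inj.
Qed.

(** Positive parts keep the factors of the product in [[0, 1]]; by
    [tempered_ge0] they coincide almost surely with the variables. *)
Lemma laplace_tempered_sum z v : 0 <= z -> 0 <= v ->
  (\int[P]_t (expR (- (z * (v * \sum_(i < n) Num.max 0 (X i t)))))%:E =
   ((1 - fine (\int[mu]_x ((1 - expR (- (z * (v * Num.max 0 x)))) * w x)%:E))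
      ^+ n)%:E)%E.
Proof.
move=> z0 v0; pose h x := expR (- (z * (v * Num.max 0 x))) : R.
have max0 x : 0 <= Num.max 0 x :> R by rewrite le_max lexx.
have h01 x : 0 <= h x <= 1.
  by rewrite expR_ge0/= -expR0 ler_expR oppr_le0 !mulr_ge0.
have mh : measurable_fun [set: R] h.
  apply: measurableT_comp; first exact: measurable_expR.
  apply: measurable_funN; apply: measurable_funM => //.
  by apply: measurable_funM => //; exact: measurable_maxr.
have mhC : measurable_fun [set: R] (fun x => 1 - h x) by exact: measurable_funB.
have hC01 x : 0 <= 1 - h x by rewrite subr_ge0; case/andP: (h01 x).
transitivity (\int[P]_t (\prod_(i < n) h (X i t))%:E)%E.
  apply: eq_integral => t _; congr EFin.
  by rewrite /h -expR_sum sumrN !mulr_sumr.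
rewrite (integral_prod_indep iidX.1 (fun _ => mh) (fun _ => h01)).
rewrite (eq_bigr (fun=> (1 - fine (\int[mu]_x ((1 - h x) * w x)%:E)%E)%:E)).
  by rewrite prodEFin big_const card_ord iter_mulr_1.
move=> i _; rewrite -(integral_tempered i mhC hC01).
have sum1 : (\int[P]_t (h (X i t))%:E + \int[P]_t (1 - h (X i t))%:E = 1)%E.
  rewrite -ge0_integralD//; last 4 first.
  - by move=> t _; rewrite lee_fin; case/andP: (h01 (X i t)).
  - by apply/measurable_EFinP; apply: measurableT_comp.
  - by move=> t _; rewrite lee_fin.
  - by apply/measurable_EFinP; apply: (measurableT_comp mhC).
  rewrite (eq_integral (cst 1%E)); last first.
    by move=> t _; rewrite -EFinD addrC subrK.
  by rewrite integral_cst// mul1e; exact: probability_setT.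
have fin2 : (\int[P]_t (1 - h (X i t))%:E)%E \is a fin_num.
  apply: (@integrable_fin_num _ _ _ P setT); first exact: measurableT.
  apply: (@integrable_bounded _ _ _ P (fun t => 1 - h (X i t)) 1).
    exact: (measurableT_comp mhC).
  by move=> t; rewrite ger0_norm// lerBlDr lerDl; case/andP: (h01 (X i t)).
rewrite EFinB fineK//.
by rewrite -sum1 addeK.
Qed.

End tempered_sample.

(** * The general limit theorem *)

Section tempered_limit.
Context {R : realType}.
Variables (alpha : R) (mu : probability (measurableTypeR R) R) (L V : R -> R).
Hypothesis halpha : 0 < alpha < 1.
Hypothesis hL : slowly_varying L.
Hypothesis htail : forall t : R, 0 < t ->
  mu `]t, +oo[%classic = (t `^ (- alpha) * L t)%:E.
Hypothesis hV : forall t : R, 0 < t -> V t = t `^ alpha / L t.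

Let alpha0 : 0 < alpha. Proof. by case/andP: halpha. Qed.

Let F t := fine (mu `]t, +oo[%classic).

Let muF t : 0 < t -> mu `]t, +oo[%classic = (F t)%:E.
Proof. by move=> t0; rewrite /F htail. Qed.

Let FE t : 0 < t -> F t = t `^ (- alpha) * L t.
Proof. by move=> t0; rewrite /F htail. Qed.

Let tF : tail_function F := tail_functionP muF.

(** A zero of [F] would force [F], hence [L], to vanish from there on, and [L
    t / L t] would be 0 instead of tending to 1. *)
Let F01 x : 0 < x -> 0 < F x <= 1.
Proof.
move=> x0; apply/andP; split; last first.
  by rewrite -lee_fin -muF// probability_le1//.
have := hL ltr01; rewrite powR1 => L1.
have L_neq0 : \forall t \near +oo, L t != 0.
  have nz : \forall t \near +oo, L (1 * t) / L t != 0.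
    by apply: cvgr_neq0 L1 _; exact: oner_neq0.
  apply: filterS nz => t.
  by apply: contraNN => /eqP ->; rewrite invr0 mulr0.
have : \forall t \near +oo, x <= t /\ L t != 0.
  by apply: filterS2 (nbhs_pinfty_ge (num_real x)) L_neq0 => t.
move=> /filter_ex[t [xt Lt]]; have t0 := lt_le_trans x0 xt.
apply: lt_le_trans (tail_le tF x0 xt).
by rewrite lt_neqAle (tail_ge0 tF)// andbT eq_sym FE// mulf_neq0// gt_eqF// powR_gt0.
Qed.

Let F_gt0 x : 0 < x -> 0 < F x. Proof. by move=> /F01 /andP[]. Qed.

Let VF t : 0 < t -> V t = (F t)^-1.
Proof. by move=> t0; rewrite hV// FE// invfM powRN invrK. Qed.

Let F_rv x : 0 < x -> F (x * t) / F t @[t --> +oo] --> x `^ (- alpha).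
Proof.
move=> x0; rewrite -[X in _ --> X]mulr1 -(powRr0 x).
apply: cvg_trans (cvgM (cvg_cst (x `^ (- alpha))) (hL x0)).
apply: near_eq_cvg; near=> t.
have t0 : 0 < t by near: t; exact: nbhs_pinfty_gt.
rewrite /= !FE ?mulr_gt0// powRM ?(ltW x0) ?(ltW t0)//.
have p0 : t `^ (- alpha) != 0 by rewrite gt_eqF// powR_gt0.
set p := t `^ _ in p0 *; rewrite invfM.
rewrite [RHS](_ : _ = x `^ (- alpha) * (p / p) * (L (x * t) / L t)); last by ring.
by rewrite divff// mulr1.
Unshelve. all: by end_near. Qed.

Let b n := gen_inverse V n%:R.

Let b_cvgy : b n @[n --> \oo] --> +oo.
Proof. exact: (gen_inverse_cvgy tF F01 VF). Qed.

Let b_gt0 : \forall n \near \oo, 0 < b n.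
Proof. by move/cvgryPgt : b_cvgy; apply. Qed.

(** The modified value only concerns finitely many [n] and makes the scaling
    by [beta n] invertible for all of them. *)
Let beta n := if 0 < b n then b n else 1.

Let beta0 n : 0 < beta n.
Proof. by rewrite /beta; case: ifP. Qed.

Let beta_b : \forall n \near \oo, beta n = b n.
Proof. by apply: filterS b_gt0 => n bn; rewrite /beta bn. Qed.

Let F_cvg x : 0 < x -> n%:R * F (x * beta n) @[n --> \oo] --> x `^ (- alpha).
Proof.
move=> x0.
apply: cvg_trans (gen_inverse_norming halpha tF F01 F_rv VF x0).
apply: near_eq_cvg; apply: filterS beta_b => n bn.
by rewrite bn.
Qed.

(** The Potter exponent is taken between [alpha] and 1, and written [(1 +
    c)^-1] with [c > 0] to fit [envelope]. *)
Let F_bound : exists C c, [/\ 1 <= C, 0 < c & \forall n \near \oo,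
  forall x, 0 < x <= 1 -> n%:R * F (x * beta n) <= C * x `^ (- (1 + c)^-1)].
Proof.
have /andP[_ alpha1] := halpha.
pose a' := (1 + alpha) / 2.
have aa' : alpha < a' by rewrite /a'; lra.
have a'1 : a' < 1 by rewrite /a'; lra.
have a'0 : 0 < a' := lt_trans alpha0 aa'.
have F2 : F (2^-1 * t) / F t @[t --> +oo] --> 2 `^ alpha.
  have h20 : 0 < 2^-1 :> R by rewrite invr_gt0.
  have := F_rv h20; rewrite -[X in X `^ (- alpha)]powR_inv1// -powRrM.
  by rewrite mulrNN mul1r.
have [C [t0 [C0 t00 CP]]] := potter_bound tF F01 a'0 aa' F2.
have c0 : 0 < a'^-1 - 1 by rewrite subr_gt0 invf_gt1.
exists (Num.max 1 (2 * C)), (a'^-1 - 1); split => //; first by rewrite le_max lexx.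
have n2 : \forall n \near \oo, n%:R * F (1 * beta n) <= 2.
  have := F_cvg ltr01; rewrite powR1 => /(cvgr_le _); apply.
  by rewrite ltr1n.
have bt : \forall n \near \oo, t0 <= b n by move/cvgryPge : b_cvgy; apply.
near=> n => x x01.
have bn : beta n = b n by near: n.
have /andP[x0 x1] := x01.
rewrite addrC subrK invrK.
apply: (@le_trans _ _ (n%:R * (C * x `^ (- a') * F (beta n)))).
  by rewrite ler_wpM2l// CP// bn; near: n.
apply: (@le_trans _ _ (2 * C * x `^ (- a'))); last first.
  by rewrite ler_pM2r ?powR_gt0// le_max lexx orbT.
rewrite mulrCA mulrC -mulrA ler_wpM2r ?mulr_ge0 ?powR_ge0 ?(ltW C0)//.
by rewrite -[beta n]mul1r; near: n.
Unshelve. all: by end_near. Qed.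

Variables (a : nat -> R) (q : R -> R) (ell : nat -> R).
Hypothesis ha : forall n, a n = (gen_inverse V n%:R)^-1.
Hypothesis hq : tempering alpha q.
Hypothesis hc : tempering_const mu q l @[l --> +oo] --> (1 : R).
Hypothesis hell0 : forall n, 0 < ell n.
Hypothesis hell : ell n @[n --> \oo] --> +oo.
Variables (d : nat -> measure_display) (T : forall n, measurableType (d n)).
Variables (P : forall n, probability (T n) R).
Variable X : forall n, 'I_n -> {RV (P n) >-> R}.
Hypothesis hX : forall n, 0 < tempering_mass mu q (ell n) ->
  iid_with_law (@X n) (tempered_law mu q (ell n)).

Let a_ge0 n : 0 <= a n.
Proof.
rewrite ha invr_ge0 /gen_inverse.
set S := [set s | _]; have [S0|/set0P S0] := eqVneq S set0.
  by rewrite S0 inf0.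
by apply: lb_le_inf => // s [/ltW].
Qed.

Lemma norming_gt0 : \forall n \near \oo, 0 < a n.
Proof. by apply: filterS b_gt0 => n bn; rewrite ha invr_gt0. Qed.

Let a_beta : \forall n \near \oo, a n = (beta n)^-1.
Proof. by apply: filterS beta_b => n ->; rewrite ha. Qed.

Let const_cvg : tempering_const mu q (ell n) @[n --> \oo] --> (1 : R).
Proof. exact: cvg_comp hell hc. Qed.

Let mass_gt0 : \forall n \near \oo, 0 < tempering_mass mu q (ell n).
Proof.
have := const_cvg => /(cvgr_gt _) /(_ 0 ltr01); apply: filterS => n.
by rewrite /tempering_const invr_gt0.
Qed.

(** Replacing the variables by their positive parts makes the sums nonnegative
    everywhere and does not change their law once the tempered law is well
    defined. *)
Let Y n (w : T n) : R := a n * \sum_(i < n) Num.max 0 (X i w).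

Let mY n : measurable_fun (T := T n) (U := measurableTypeR R) [set: T n] (@Y n).
Proof.
have mXi (i : 'I_n) : measurable_fun [set: T n] (fun w => Num.max 0 (X i w)).
  by apply: measurable_maxr => //; exact: measurable_funP.
have : measurable_fun [set: T n] (@Y n).
  by apply: measurable_funM => //; exact: measurable_sum.
exact.
Qed.

Let Yf n : {mfun T n >-> measurableTypeR R} := HB.pack_for
  {mfun T n >-> measurableTypeR R} (@Y n) (isMeasurableFun.Build _ _ _ _ _ (@mY n)).

Let lam n : probability (measurableTypeR R) R := distribution (P n) (Yf n).

Let Y_ge0 n w : 0 <= @Y n w.
Proof.
rewrite mulr_ge0// sumr_ge0// => i _.
by rewrite le_max lexx.
Qed.

Let lam0 n : lam n `[0, +oo[%classic = 1%E.
Proof.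
rewrite /lam /= /distribution /pushforward [X in P n X](_ : _ = setT).
  exact: probability_setT.
by apply/seteqP; split => // w _; rewrite /= in_itv/= Y_ge0.
Qed.

(** The three regimes differ only by the limit [qs] of the rescaled tempering
    function, in the sense of convergence along every convergent sequence of
    points; [N] contains the points where this may fail. *)
Lemma tempered_sums_cvg (m : {measure set (measurableTypeR R) -> \bar R})
    (N : set (measurableTypeR R)) (qs : R -> R) :
  has_density m (levy_density alpha alpha (cst 1)) ->
  measurable N -> m N = 0%E ->
  measurable_fun (`[0, +oo[%classic : set R) qs ->
  (exists K, forall x, 0 <= x -> 0 <= qs x <= K) ->
  (forall (x : R) (u : nat -> R), 0 < x -> ~ N x -> u n @[n --> \oo] --> x ->
     rescale q (a n * ell n) (u n) @[n --> \oo] --> qs x) ->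
  exists2 nu : probability (measurableTypeR R) R,
    PTS alpha qs alpha nu &
    cvg_in_distribution P (fun n w => a n * \sum_(i < n) X i w) nu.
Proof.
move=> mE mN N0 mqs [K qsK] qn_qs.
have [mq q0 [Kq qK] _ _] := hq.
have [C [c [C1 c0 FC]]] := F_bound.
have qs0 x : 0 <= x -> 0 <= qs x by move=> /qsK /andP[].
pose qn n := rescale q (a n * ell n).
have al0 n : 0 <= a n * ell n by rewrite mulr_ge0// ltW.
have mqn n : measurable_fun (`[0, +oo[%classic : set R) (qn n).
  exact: measurable_rescale.
have qn0 n x : 0 <= x -> 0 <= qn n x.
  by move=> x0; apply: q0; rewrite divr_ge0.
have qnK n x : 0 <= x -> qn n x <= Kq.
  by move=> x0; apply: qK; rewrite divr_ge0.
have mT := stable_levy_tail alpha0 mE.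
pose psi := levy_exponent m qs.
have psiE z : 0 <= z -> (\int[m]_x (levy_integrand z qs x)%:E = (psi z)%:E)%E.
  by move=> z0; apply: (integral_levy_integrand halpha mE mqs qsK z0).
pose J n z := fine (\int[mu]_x (levy_integrand z (qn n) (x / beta n))%:E)%E.
have qn0K n x : 0 <= x -> 0 <= qn n x <= Kq by move=> x0; rewrite qn0 ?qnK.
have mJ n z : measurable_fun [set: R] (fun x => levy_integrand z (qn n) (x / beta n)).
  apply: measurableT_comp; first exact: measurable_levy_integrand.
  exact: measurable_funM.
have JE n z : 0 <= z ->
    (\int[mu]_x (levy_integrand z (qn n) (x / beta n))%:E = (J n z)%:E)%E.
  move=> z0; rewrite /J fineK//; apply: (@integrable_fin_num _ _ _ mu setT) => //.
  apply: (@integrable_bounded _ _ _ mu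
    (fun x => levy_integrand z (qn n) (x / beta n)) (Kq * Num.max 1 z)); first exact: mJ.
  move=> x.
  rewrite ger0_norm ?levy_integrand_ge0//; last exact: qn0.
  have Kq0 : 0 <= Kq by have /andP[qn00] := qn0K n 0 (lexx 0); exact: le_trans.
  have M0 : 0 <= Num.max 1 z by rewrite le_max ler01.
  have [x0|x0] := leP (x / beta n) 0; first by rewrite levy_integrand_npos// mulr_ge0.
  apply: (le_trans (levy_integrand_le (qn0K n) z0 (ltW x0))).
  by rewrite ler_piMr ?mulr_ge0// ge_min lexx.
have J0 n z : 0 <= z -> 0 <= J n z.
  move=> z0; rewrite /J fine_ge0// integral_ge0// => x _.
  by rewrite lee_fin levy_integrand_ge0//; exact: qn0.
have expo z : 0 <= z -> n%:R * J n z @[n --> \oo] --> psi z.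
  move=> z0.
  have [_] := levy_exponent_cvg alpha0 muF beta0 F_cvg C1 c0 FC mT
    mqn qn0 qnK mqs qs0 mN N0 qn_qs z0.
  rewrite psiE// => /fine_cvg; apply: cvg_trans; apply: near_eq_cvg.
  by apply: nearW => n /=; rewrite JE.
have lam_phi z : 0 <= z ->
    (\int[lam n]_(x in `[0%R, +oo[) (expR (- (z * x)))%:E)%E @[n --> \oo] -->
    (expR (- psi z))%:E.
  move=> z0.
  pose y n := tempering_const mu q (ell n) * J n z.
  have y0 : \forall n \near \oo, 0 <= y n.
    apply: filterS mass_gt0 => n massn.
    by rewrite mulr_ge0 ?J0// invr_ge0 ltW.
  have ny : n%:R * y n @[n --> \oo] --> psi z.
    rewrite -[X in _ --> X]mul1r; apply: cvg_trans (cvgM const_cvg (expo z z0)).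
    by apply: near_eq_cvg; apply: nearW => n; rewrite /= mulrCA.
  have yc : ((1 - y n) ^+ n)%:E @[n --> \oo] --> (expR (- psi z))%:E.
    by apply: cvg_EFin; [exact: nearW|exact: cvg_onem_expR].
  apply: cvg_trans yc; apply: near_eq_cvg; near=> n.
  have an : a n = (beta n)^-1 by near: n.
  have massn : 0 < tempering_mass mu q (ell n) by near: n.
  have mexp : measurable_fun [set: R] (fun x => (expR (- (z * x)))%:E).
    apply/measurable_EFinP; apply: measurableT_comp; first exact: measurable_expR.
    by apply: measurable_funN; apply: measurable_funM.
  have exp0 x : (0 <= (expR (- (z * x)))%:E)%E by rewrite lee_fin expR_ge0.
  rewrite -(ge0_integral_pos (lam0 n) mexp exp0).
  rewrite /lam ge0_integral_distribution//.
  rewrite [RHS](laplace_tempered_sum mq q0 (ltW (hell0 n)) massn (hX massn) z0 (a_ge0 n)).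
  congr ((1 - _) ^+ n)%:E; rewrite /y; apply/esym.
  transitivity (fine ((tempering_const mu q (ell n))%:E * (J n z)%:E)%E); last first.
    by rewrite -EFinM.
  congr fine; rewrite -JE// -ge0_integralZl//; last 3 first.
  - by apply/measurable_EFinP; exact: mJ.
  - by move=> x _; rewrite lee_fin levy_integrand_ge0//; exact: qn0.
  - by rewrite lee_fin invr_ge0 ltW.
  apply: eq_integral => x _; rewrite -EFinM; congr EFin.
  rewrite mulrCA; congr (_ * _).
  have [x0|x0] := leP x 0.
    by rewrite mulr0 mulr0 oppr0 expR0 subrr mul0r levy_integrand_npos// pmulr_lle0 ?invr_gt0.
  rewrite levy_integrand_pos ?divr_gt0// patchE mem_setE in_itv/= (ltW x0).
  rewrite an mulrCA /qn /rescale an; congr ((1 - expR (- _)) * q _).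
    by ring.
  by rewrite invfM invrK mulrA divfK// gt_eqF.
have small e : 0 < e -> exists2 z, 0 < z & 1 - expR (- psi z) < e.
  exact: (levy_exponent_small halpha mE mqs qsK).
have [nu [nu0 nuL nuC]] := laplace_continuity_theorem lam0 lam_phi small.
exists nu; first exact: (PTS_limit_law halpha mE mqs qsK nu0 nuL).
move=> f cf fb; apply: cvg_trans (nuC f cf fb); apply: near_eq_cvg; near=> n.
have massn : 0 < tempering_mass mu q (ell n) by near: n.
have mf : measurable_fun [set: R] f by exact: continuous_measurable_fun.
have bY : (P n).-integrable setT (EFin \o (f \o Yf n)).
  have [K' fK] := fb.
  apply: (@integrable_bounded _ _ _ (P n) (f \o Yf n) K'); last by move=> t; exact: fK.
  exact: (measurableT_comp mf (@mY n)).
rewrite /lam integral_distribution//; last exact/measurable_EFinP.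
rewrite unlock; apply: ae_eq_integral => //.
- exact: measurable_int bY.
- apply/measurable_EFinP; apply: (measurableT_comp mf); apply: measurable_funM => //.
  by apply: measurable_sum => i; exact: measurable_funP.
- apply: filterS (tempered_ge0 (hX massn)) => t Xt _ /=; congr (f (_ * _))%:E.
  by apply: eq_bigr => i _; apply/max_idPr.
Unshelve. all: by end_near. Qed.

End tempered_limit.

(** * Scaling null sets, and the three regimes *)

(** The tails of [m] are powers, so scaling multiplies [m] by a constant on
    ]0, +oo[. *)
Lemma stable_levy_scale_null {R : realType} (a c : R)
    (m : {measure set (measurableTypeR R) -> \bar R}) : 0 < a -> 0 < c ->
  (forall x, 0 < x -> m `]x, +oo[%classic = (x `^ (- a))%:E) ->
  forall A : set R, measurable A -> A `<=` `]0, +oo[ -> m A = 0%E ->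
    m ((fun x => x / c) @^-1` A) = 0%E.
Proof.
move=> a0 c0 mT A mA A0 mA0.
have mphi : measurable_fun (T := measurableTypeR R) (U := measurableTypeR R)
  setT (fun x : R => x / c) by exact: measurable_funM.
pose phi : {mfun measurableTypeR R >-> measurableTypeR R} := HB.pack_for
  {mfun measurableTypeR R >-> measurableTypeR R}
  (fun x : R => x / c) (isMeasurableFun.Build _ _ _ _ _ mphi).
have k0 : 0 <= c `^ (- a) by exact: powR_ge0.
transitivity (mscale (NngNum k0) m A); last by rewrite /mscale mA0 mule0.
have ray x : 0 < x -> phi @^-1` `]x, +oo[%classic = `]x * c, +oo[%classic.
  by move=> x0; apply/seteqP; split => y /=; rewrite !in_itv/= !andbT ltr_pdivlMr.
have pushE x : 0 < x ->
    pushforward m phi `]x, +oo[%classic = ((x * c) `^ (- a))%:E.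
  by move=> x0; rewrite -mT ?mulr_gt0//; congr (m _); exact: ray.
apply: (@measure_eq_rays R (pushforward m phi) (mscale (NngNum k0) m)) => //.
  move=> x x0; transitivity ((x * c) `^ (- a))%:E; first exact: pushE.
  by rewrite powRM ?(ltW x0) ?(ltW c0)// mulrC EFinM -(mT _ x0).
move=> x x0; apply: (@le_lt_trans _ _ ((x * c) `^ (- a))%:E); last exact: ltry.
by rewrite le_eqVlt; apply/orP; left; apply/eqP; exact: pushE.
Qed.

(** A countable intersection of open sets covers the discontinuities without
    increasing their outer measure; scaling by [c] keeps it null for [m]. *)
Lemma discontinuities_null_cover {R : realType} (a c : R) (q : R -> R)
    (m : {measure set (measurableTypeR R) -> \bar R}) : 0 < a -> 0 < c ->
  has_density m (levy_density a a (cst 1)) ->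
  lebesgue_measure (discontinuities q) = 0%E ->
  exists N : set (measurableTypeR R), [/\ measurable N, m N = 0%E &
    forall x, 0 < x -> discontinuities q (x / c) -> N x].
Proof.
move=> a0 c0 mE D0.
have [G [oG DG G0]] := outer_measure_Gdelta (discontinuities q).
have mG : measurable (\bigcap_i G i : set R).
  by apply: bigcap_measurable; [exists 0%N|move=> i _; exact: open_measurable].
pose A := \bigcap_i G i `&` `]0, +oo[%classic.
have mA : measurable (A : set R) by apply: measurableI => //; exact: measurable_itv.
have A0 : lebesgue_measure A = 0%E.
  apply: (@subset_measure0 _ (measurableTypeR R) _ lebesgue_measure _ (\bigcap_i G i)) => //.
  by move=> x [].
  exact: (etrans G0 D0).
have mA0 : m A = 0%E.
  rewrite mE//; apply: null_set_integral => //.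
  apply/measurable_EFinP; apply: measurable_funTS.
  by apply: measurable_levy_density; exact: measurable_cst.
exists ((fun x => x / c) @^-1` A); split.
- have mphi : measurable_fun (T := measurableTypeR R) (U := measurableTypeR R)
    setT (fun x : R => x / c) by exact: measurable_funM.
  by rewrite -[X in measurable X]setTI; exact: mphi.
- by apply: (stable_levy_scale_null a0 c0 (stable_levy_tail a0 mE)) => // x [].
- move=> x x0 Dx; split; first exact: DG.
  by rewrite /= in_itv/= divr_gt0.
Qed.

Theorem theorem7 (R : realType) (alpha : R)
  (halpha : 0 < alpha < 1)
  (mu : probability (measurableTypeR R) R)
  (hmu : mu `[0, +oo[%classic = 1%E)
  (L : R -> R) (hL : slowly_varying L)
  (htail : forall t : R, 0 < t -> mu `]t, +oo[%classic = (t `^ (- alpha) * L t)%:E)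
  (V : R -> R) (hV : forall t : R, 0 < t -> V t = t `^ alpha / L t)
  (a : nat -> R) (ha : forall n : nat, a n = (gen_inverse V n%:R)^-1)
  (q : R -> R) (hq : tempering alpha q)
  (hc : tempering_const mu q ell @[ell --> +oo] --> (1 : R))
  (ell : nat -> R) (hell0 : forall n : nat, 0 < ell n)
  (hell : ell n @[n --> \oo] --> +oo)
  (d : nat -> measure_display) (T : forall n : nat, measurableType (d n))
  (P : forall n : nat, probability (T n) R)
  (X : forall n : nat, 'I_n -> {RV (P n) >-> R})
  (hX : forall n : nat, 0 < tempering_mass mu q (ell n) ->
     iid_with_law (X n) (tempered_law mu q (ell n)))
  (hD : lebesgue_measure (discontinuities q) = 0%E) :
  [/\ (forall c : R, 0 < c -> a n * ell n @[n --> \oo] --> c ->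
        exists2 nu : probability (measurableTypeR R) R,
          PTS alpha (rescale q c) alpha nu &
          cvg_in_distribution P (fun n w => a n * \sum_(i < n) X n i w) nu),
      (a n * ell n @[n --> \oo] --> +oo ->
        exists2 nu : probability (measurableTypeR R) R,
          PS alpha alpha nu &
          cvg_in_distribution P (fun n w => a n * \sum_(i < n) X n i w) nu) &
      (forall zeta : R, a n * ell n @[n --> \oo] --> (0 : R) ->
        q x @[x --> +oo] --> zeta ->
        exists2 nu : probability (measurableTypeR R) R,
          PS alpha (alpha * zeta) nu &
          cvg_in_distribution P (fun n w => a n * \sum_(i < n) X n i w) nu)].
Proof.
have [halpha0 _] := andP halpha.
have [mq q0 [K qK] q1 _] := hq.
have [m mE] := levy_measure_exists alpha (ltW halpha0)
  (measurable_cst (1 : R)) (fun _ _ => ler01).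
have core := tempered_sums_cvg halpha hL htail hV ha hq hc hell0 hell hX mE.
have al_gt0 : \forall n \near \oo, 0 < a n * ell n.
  by apply: filterS (norming_gt0 hL htail hV ha) => n an; rewrite mulr_gt0.
have u_gt0 (u : nat -> R) (x : R) : 0 < x -> u n @[n --> \oo] --> x ->
    \forall n \near \oo, 0 < u n / (a n * ell n).
  move=> x0 ux; have un0 : \forall n \near \oo, 0 < u n by apply: (cvgr_gt _ ux).
  by apply: filterS2 un0 al_gt0 => n un al; rewrite divr_gt0.
have within_cvg (u : nat -> R) (p : R) (D : set R) : u n @[n --> \oo] --> p ->
    (\forall n \near \oo, D (u n)) -> u n @[n --> \oo] --> within D (nbhs p).
  move=> up uD A WA; have := up _ WA.
  by apply: filterS2 uD => n Dn; apply.
split.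
- move=> c c0 alc.
  have [N [mN N0 DN]] := discontinuities_null_cover halpha0 c0 mE hD.
  apply: (core N) => //.
  + exact: measurable_rescale (ltW c0) mq.
  + by exists K => x x0; rewrite q0 ?qK// divr_ge0// ltW.
  move=> x u x0 Nx ux; rewrite /rescale.
  have Cx : q y @[y --> within (`[0, +oo[%classic : set R) (nbhs (x / c))] --> q (x / c).
    apply: contrapT => nC; apply: Nx; apply: DN => //; split => //.
    by rewrite divr_ge0// ltW.
  apply: cvg_comp Cx; apply: within_cvg.
    by apply: cvgM => //; apply: cvgV => //; rewrite gt_eqF.
  by apply: filterS (u_gt0 u x x0 ux) => n un; rewrite /= in_itv/= ltW.
- move=> aly; apply: (core set0) => //.
  + by exists 1 => x _; rewrite /= ler01 lexx.
  move=> x u x0 _ ux; rewrite /rescale.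
  apply: cvg_comp q1; apply: within_cvg; last exact: u_gt0 x0 ux.
  rewrite -(mulr0 x); apply: cvgM => //.
  by apply/gtr0_cvgV0.
- move=> zeta al0 qz.
  have zeta0 : 0 <= zeta.
    have qpos : \forall x \near +oo, 0 <= q x.
      by apply: filterS (nbhs_pinfty_ge (num_real 0)) => x; exact: q0.
    have := cvg_lim (@Rhausdorff R) qz => <-.
    by apply: limr_ge => //; apply/cvg_ex; exists zeta.
  have [nu [M MD MI] nuC] : exists2 nu : probability (measurableTypeR R) R,
      PTS alpha (cst zeta) alpha nu &
      cvg_in_distribution P (fun n w => a n * \sum_(i < n) X n i w) nu.
    apply: (core set0) => //.
    + by exists zeta => x _; rewrite /= zeta0 lexx.
    move=> x u x0 _ ux; rewrite /rescale; apply: cvg_comp qz.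
    apply/(gtr0_cvgV0 (u_gt0 u x x0 ux)).
    (* The argument of [q] tends to infinity because its inverse tends to 0
       from above. *)
    have al_u : a n * ell n / u n @[n --> \oo] --> (0 : R).
      by rewrite -(mul0r x^-1); apply: cvgM => //; apply: cvgV => //; rewrite gt_eqF.
    apply: cvg_trans al_u; apply: near_eq_cvg; apply: nearW => n.
    exact/esym/invf_div.
  exists nu => //; exists M => // A mA; rewrite MD//.
  by apply: eq_integral => x _; rewrite !levy_densityE /= /patch; case: ifP => _; rewrite ?mulr1 ?mulr0.
Qed.
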